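(* Let $\Gamma$ be a compact metric graph with Euler characteristic $\chi(\Gamma)$, and let $E$ be a vector bundle of rank $n$ and degree $d$ on $\Gamma$. Let $\mathcal{H}_\Gamma(K_\Gamma)$ be the line bundle associated to the canonical divisor $K_\Gamma$. Then \[ r_\Gamma(E)-r_\Gamma\big(\mathcal{H}_\Gamma(K_\Gamma)\otimes E^\ast\big)=d+n\,\chi(\Gamma). \]
   Context: A metric graph is a metric space in which every point has a neighbourhood isometric to a star-shaped domain $\{te^{2\pi i k/m}\in\mathbb{C}: 0\le t\le r,\ k=0,\dots,m-1\}$ (path metric). A compact metric graph is obtained from a finite graph $G$ with edge lengths $\ell$ by gluing segments; $(G,\ell)$ is a model, simple if $G$ has no loops or multiple edges. $\chi(\Gamma)=\#V(G)-\#E(G)$ (additive over connected components); a connected $\Gamma$ has genus $g=1-\chi(\Gamma)$. A piecewise linear function is continuous and piecewise linear with integer slopes along segments; $\mathrm{ord}_p(f)$ is the sum of outgoing slopes of $f$ at $p$ and $\mathrm{div}(f)=\sum_p \mathrm{ord}_p(f)\,p$. A divisor is a formal $\mathbb{Z}$-combination of points with discrete support; $D\sim D'$ if $D-D'=\mathrm{div}(f)$ for a global piecewise linear $f$. The sheaf $\mathcal{H}_\Gamma$ of harmonic functions consists of piecewise linear functions with $\mathrm{div}(f)=0$. For a divisor $D$, $\mathcal{H}_\Gamma(D)$ is the $\mathcal{H}_\Gamma$-torsor $U\mapsto\{s\ \text{piecewise linear on } U:\ \mathrm{div}(s)=D|_U\}$ (with $\mathcal{H}_\Gamma$ acting by addition);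 this gives a bijection between divisor classes and line bundles ($\mathcal{H}_\Gamma$-torsors). A vector bundle of rank $n$ on $\Gamma$ is a torsor under the sheaf of groups $S_n\ltimes\mathcal{H}_\Gamma^n$ ($S_n$ permuting the factors). Concretely, for an oriented simple model with star cover $\{U_v\}$ ($U_v$ = $v$ together with the open edges at $v$), it is given by transition data on each edge $e$: an element $(\sigma^e,g^e_1,\dots,g^e_n)$ with $\sigma^e\in S_n$ and $g^e_i$ harmonic (affine, integer slope) on $e$, written as a matrix $g^e_{ij}$ over $\mathbb{T}=\mathbb{R}\cup\{\infty\}$ with $g^e_{i\sigma^e(i)}=g^e_i$ and all other entries $\infty$; isomorphism classes correspond to cohomology classes. The degree of $E$ is the sum over all edges of the slopes (in the edge's orientation) of all finite entries. Tensor product $E\otimes F$: Kronecker product with $((i,k),(j,l))$-entry $g^e_{ij}+h^e_{kl}$. Dual $E^\ast$: replace each finite entry by its negative. A free cover $f:\widetilde\Gamma\to\Gamma$ of degree $n$ is an isometric covering map of degree $n$ ($\widetilde\Gamma$ possibly disconnected). Pushforward $f_\ast$ of a line bundle on $\widetilde\Gamma$: choose compatible models, label the preimages of each vertex $v$ as $\tilde v_1,\dots,\tilde v_n$ and of each edge $e$ as $\tilde e_1,\dots,\tilde e_n$ with $s(\tilde e_k)=\widetilde{s(e)}_k$, define $\sigma^e$ by $t(\tilde e_k)=\widetilde{t(e)}_{\sigma^e(k)}$; then $f_\ast L$ has transition matrix on $e$ with $(k,\sigma^e(k))$-entry equal to the transition function of $L$ on $\tilde e_k$ and $\infty$ elsewhere.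 Every rank-$n$ vector bundle $E$ is isomorphic to $f_\ast\mathcal{H}_{\widetilde\Gamma}(D)$ for some free cover $f$ of degree $n$ and divisor $D$ on $\widetilde\Gamma$. Baker--Norine rank: for $\Gamma$ connected, $r_\Gamma(D)=-1$ if $D$ is not linearly equivalent to an effective divisor, otherwise the largest $r\ge0$ such that $D-E'$ is equivalent to an effective divisor for every effective $E'$ of degree $r$. For $\Gamma=\Gamma_1\sqcup\dots\sqcup\Gamma_k$ (connected components), $r_\Gamma(D)=\sum_{i=1}^k r_{\Gamma_i}(D|_{\Gamma_i})+k-1$. The canonical divisor is $K_\Gamma=\sum_p(\mathrm{val}(p)-2)\,p$. The Baker--Norine rank of a vector bundle $E$ is $r_\Gamma(E)=r_{\widetilde\Gamma}(D)$ for any free cover $f:\widetilde\Gamma\to\Gamma$ and divisor $D$ on $\widetilde\Gamma$ with $f_\ast\mathcal{H}_{\widetilde\Gamma}(D)\simeq E$ (independent of choice). *)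

(* Defs.v *)
From HB Require Import structures.
From mathcomp Require Import all_boot all_order fingroup perm all_algebra.
From mathcomp Require Import reals.

Set Implicit Arguments.
Unset Strict Implicit.
Unset Printing Implicit Defensive.
Import Order.TTheory GRing.Theory Num.Theory.
Local Open Scope ring_scope.

Section MetricGraphs.
Variable R : realType.

(* Models of compact metric graphs: finite graph (V, E, src, tgt) with *)
(* edge lengths.  Edge e is the segment [0, len e], 0 at src e.        *)
Record model := Model {
  mV : finType;
  mE : finType;
  msrc : mE -> mV;
  mtgt : mE -> mV;
  mlen : mE -> R }.

Arguments mV : clear implicits.
Arguments mE : clear implicits.
Arguments msrc : clear implicits.
Arguments mtgt : clear implicits.
Arguments mlen : clear implicits.

Definition lengths_pos (G : model) := forall e, 0 < mlen G e.

Definition simple_model (G : model) :=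
  (forall e, msrc G e != mtgt G e) /\
  (forall e e', e != e' ->
     ~ (msrc G e = msrc G e' /\ mtgt G e = mtgt G e') /\
     ~ (msrc G e = mtgt G e' /\ mtgt G e = msrc G e')).

Definition interior (G : model) (x : mE G * R) : bool :=
  (0 < x.2) && (x.2 < mlen G x.1).
Arguments interior : clear implicits.

Definition point (G : model) := (mV G + {x : mE G * R | interior G x})%type.

Definition divisor (G : model) := seq (point G * int).

Definition coefV (G : model) (D : divisor G) (v : mV G) : int :=
  \sum_(x <- D) (match x.1 with inl w => if w == v then x.2 else 0 | inr _ => 0 end).
Definition coefI (G : model) (D : divisor G) (e : mE G) (t : R) : int :=
  \sum_(x <- D) (match x.1 with inl _ => 0 | inr y => if val y == (e, t) then x.2 else 0 end).
Definition degD (G : model) (D : divisor G) : int := \sum_(x <- D) x.2.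
Definition subD (G : model) (D D' : divisor G) : divisor G :=
  D ++ [seq (x.1, - x.2) | x <- D'].
Definition effective (G : model) (D : divisor G) :=
  (forall v, 0 <= coefV D v) /\ (forall e t, 0 <= coefI D e t).

(* Global piecewise linear functions (finitely many breakpoints, which *)
(* is automatic on a compact graph).  On edge e the function is        *)
(*   t |-> pl_c (src e) + pl_s0 e * t + sum_{(q,k) in pl_k e} k*max(0,t-q) *)
(* (every continuous PL function with integer slopes has this form).   *)
Record plfun (G : model) := PLFun {
  pl_c : mV G -> R;
  pl_s0 : mE G -> int;
  pl_k : mE G -> seq (R * int) }.

Definition plfun_valid (G : model) (f : plfun G) :=
  forall e, all (fun x => interior G (e, x.1)) (pl_k f e) /\
    pl_c f (mtgt G e) = pl_c f (msrc G e) + (pl_s0 f e)%:~R * mlen G e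
        + \sum_(x <- pl_k f e) (x.2)%:~R * (mlen G e - x.1).

(* ord_v(f): sum of outgoing slopes *)
Definition divV (G : model) (f : plfun G) (v : mV G) : int :=
  \sum_(e | msrc G e == v) pl_s0 f e
  - \sum_(e | mtgt G e == v) (pl_s0 f e + \sum_(x <- pl_k f e) x.2).
Definition divI (G : model) (f : plfun G) (e : mE G) (t : R) : int :=
  \sum_(x <- pl_k f e | x.1 == t) x.2.

Definition lin_equiv (G : model) (D D' : divisor G) :=
  exists f : plfun G, plfun_valid f /\
    (forall v, coefV D v - coefV D' v = divV f v) /\
    (forall e t, interior G (e, t) -> coefI D e t - coefI D' e t = divI f e t).

Definition adjV (G : model) : rel (mV G) := fun x y =>
  [exists e, ((msrc G e == x) && (mtgt G e == y)) || ((msrc G e == y) && (mtgt G e == x))].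
Arguments adjV : clear implicits.
Definition compo (G : model) (x : mV G) : {set mV G} := [set y | connect (adjV G) x y].
Definition components (G : model) : {set {set mV G}} := [set compo x | x : mV G].

Arguments components : clear implicits.

Definition in_comp (G : model) (C : {set mV G}) (p : point G) : bool :=
  match p with inl v => v \in C | inr y => msrc G (val y).1 \in C end.
Definition supported_on (G : model) (C : {set mV G}) (D : divisor G) :=
  (forall v, v \notin C -> coefV D v = 0) /\
  (forall e t, msrc G e \notin C -> coefI D e t = 0).
Definition restrD (G : model) (C : {set mV G}) (D : divisor G) : divisor G :=
  [seq x <- D | in_comp C x.1].

Definition eff_class_on (G : model) (C : {set mV G}) (D : divisor G) :=
  exists D', effective D' /\ supported_on C D' /\ lin_equiv D D'.
Definition rank_prop (G : model) (C : {set mV G}) (D : divisor G) (r : int) :=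
  forall E', effective E' -> supported_on C E' -> degD E' = r ->
    eff_class_on C (subD (restrD C D) E').
Definition is_rank_conn (G : model) (C : {set mV G}) (D : divisor G) (r : int) :=
  (~ eff_class_on C (restrD C D) /\ r = -1) \/
  (0 <= r /\ rank_prop C D r /\ forall r', r < r' -> ~ rank_prop C D r').
Definition is_BN_rank (G : model) (D : divisor G) (r : int) :=
  exists rc : {set mV G} -> int,
    (forall C, C \in components G -> is_rank_conn C D (rc C)) /\
    r = \sum_(C in components G) rc C + (#|components G|)%:Z - 1.

Definition incident (G : model) (e : mE G) (v : mV G) : bool :=
  (msrc G e == v) || (mtgt G e == v).
(* distance from v of the point (e,t), e incident to v *)
Definition distv (G : model) (v : mV G) (e : mE G) (t : R) : R :=
  if msrc G e == v then t else mlen G e - t.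

(* PL function on the star U_v: on incident edge e, at distance u from v,
   value ss_c + ss_s0 e * u + sum_{(q,k)} k * max(0, u - q). *)
Record starsec (G : model) := StarSec {
  ss_c : R;
  ss_s0 : mE G -> int;
  ss_k : mE G -> seq (R * int) }.

Definition star_val (G : model) (v : mV G) (s : starsec G) (e : mE G) (t : R) : R :=
  let u := distv v e t in
  ss_c s + (ss_s0 s e)%:~R * u + \sum_(x <- ss_k s e) (x.2)%:~R * Num.max 0 (u - x.1).

(* s is a section of H(D) on U_v, i.e. div s = D|_{U_v} *)
Definition is_section (G : model) (D : divisor G) (v : mV G) (s : starsec G) :=
  \sum_(e | incident e v) ss_s0 s e = coefV D v /\
  forall e, incident e v ->
    all (fun x => interior G (e, x.1)) (ss_k s e) /\
    forall t, interior G (e, t) ->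
      coefI D e t = \sum_(x <- ss_k s e | x.1 == distv v e t) x.2.

(* affine functions a.1 + a.2 * t (integer slope) on an edge *)
Definition aff := (R * int)%type.
Definition addA (a b : aff) : aff := (a.1 + b.1, a.2 + b.2).
Definition negA (a : aff) : aff := (- a.1, - a.2).

Definition lb_transition (G : model) (s : mV G -> starsec G) (e : mE G) (a : aff) :=
  forall t, interior G (e, t) ->
    star_val (msrc G e) (s (msrc G e)) e t - star_val (mtgt G e) (s (mtgt G e)) e t
    = a.1 + (a.2)%:~R * t.

(* Vector bundles: transition data in S_I |x H^I on each edge.  The    *)
(* pair (sigma, g) stands for the tropical matrix M with               *)
(* M_{i, sigma i} = g i and all other entries infinity.                *)
Definition cocycle (G : model) (I : finType) := mE G -> ({perm I} * (I -> aff))%type.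

(* tropical matrix product and inverse of monomial matrices
   (note (s * t) x = t (s x) for mathcomp permutations) *)
Definition gmul (I : finType) (P Q : {perm I} * (I -> aff)) : {perm I} * (I -> aff) :=
  ((P.1 * Q.1)%g, fun i => addA (P.2 i) (Q.2 (P.1 i))).
Definition ginv (I : finType) (P : {perm I} * (I -> aff)) : {perm I} * (I -> aff) :=
  ((P.1^-1)%g, fun j => negA (P.2 ((P.1^-1)%g j))).

(* harmonic functions on the star U_v: value h.1 at v, outgoing slope h.2 e *)
Definition harm (G : model) := (R * (mE G -> int))%type.
Definition harm_ok (G : model) (v : mV G) (h : harm G) :=
  \sum_(e | incident e v) h.2 e = 0.
Definition restrH (G : model) (v : mV G) (h : harm G) (e : mE G) : aff :=
  if msrc G e == v then (h.1, h.2 e)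
  else (h.1 + (h.2 e)%:~R * mlen G e, - h.2 e).
Definition restrG (G : model) (I : finType) (v : mV G)
  (h : {perm I} * (I -> harm G)) (e : mE G) : {perm I} * (I -> aff) :=
  (h.1, fun i => restrH v (h.2 i) e).

(* isomorphism of bundles = cohomologous transition data *)
Definition bundle_iso (G : model) (I : finType) (E E' : cocycle G I) :=
  exists h : mV G -> {perm I} * (I -> harm G),
    (forall v i, harm_ok v ((h v).2 i)) /\
    forall e, E' e = gmul (gmul (restrG (msrc G e) (h (msrc G e)) e) (E e))
                          (ginv (restrG (mtgt G e) (h (mtgt G e)) e)).

Definition bdeg (G : model) (I : finType) (E : cocycle G I) : int :=
  \sum_(e : mE G) \sum_(i : I) ((E e).2 i).2.

Definition dual (G : model) (I : finType) (E : cocycle G I) : cocycle G I :=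
  fun e => ((E e).1, fun i => negA ((E e).2 i)).

Definition pprod_fun (I J : finType) (s : {perm I}) (t : {perm J}) (x : (I * J)%type)
  : (I * J)%type := (s x.1, t x.2).
Lemma pprod_inj (I J : finType) (s : {perm I}) (t : {perm J}) : injective (pprod_fun s t).
Proof.
by move=> [a b] [c d] [] /perm_inj -> /perm_inj ->.
Qed.
Definition pprod (I J : finType) (s : {perm I}) (t : {perm J}) : {perm (I * J)%type} :=
  perm (@pprod_inj I J s t).

Definition tensor (G : model) (I J : finType) (E : cocycle G I) (F : cocycle G J)
  : cocycle G (I * J)%type :=
  fun e => (pprod (E e).1 (F e).1, fun x => addA ((E e).2 x.1) ((F e).2 x.2)).

Definition is_lb_cocycle (G : model) (s : mV G -> starsec G) (L : cocycle G 'I_1) :=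
  forall e, (L e).1 = 1%g /\ lb_transition s e ((L e).2 ord0).

Definition cover_model (G : model) (I : finType) (sig : mE G -> {perm I}) : model :=
  @Model (mV G * I)%type (mE G * I)%type
    (fun x => (msrc G x.1, x.2))
    (fun x => (mtgt G x.1, sig x.1 x.2))
    (fun x => mlen G x.1).
Arguments cover_model : clear implicits.

(* P is the transition data of f_* H(D), with sections s of H(D) *)
Definition is_pushforward (G : model) (I : finType) (sig : mE G -> {perm I})
  (s : mV (cover_model G I sig) -> starsec (cover_model G I sig)) (P : cocycle G I) :=
  forall e, (P e).1 = sig e /\
    forall k, lb_transition s ((e, k) : mE (cover_model G I sig)) ((P e).2 k).

(* r is the Baker--Norine rank of E: E = f_* H(D) and r = r(D) *)
Definition is_bundle_rank (G : model) (I : finType) (E : cocycle G I) (r : int) :=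
  exists (sig : mE G -> {perm I}) (D : divisor (cover_model G I sig))
         (s : mV (cover_model G I sig) -> starsec (cover_model G I sig)),
    (forall v, is_section D v (s v)) /\
    (exists P, is_pushforward s P /\ bundle_iso P E) /\
    is_BN_rank D r.

Definition valence (G : model) (v : mV G) : nat :=
  #|[set e | msrc G e == v]| + #|[set e | mtgt G e == v]|.
Definition canonical_div (G : model) : divisor G :=
  [seq (inl v, (valence v)%:Z - 2) | v <- enum (mV G)].
Definition euler_char (G : model) : int := (#|mV G|)%:Z - (#|mE G|)%:Z.

Arguments canonical_div : clear implicits.
Arguments euler_char : clear implicits.
End MetricGraphs.

(* Main.v *)
(* Pushing chips to the vertices identifies the class of a line bundle with a
   pair [(d, p)], [d] integral on the vertices and [p] real on the edges, up to
   the action of vertex potentials and edge slopes. Whether the class contains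
   an effective divisor becomes a system of inequalities with integer parts in
   the vertex values of a potential, and no subdivision of the graph is needed.

   If [(d, p)] is not effective, the pointwise infimum of the potentials that
   leave debt at most at [v0] is attained, because integer parts are upper
   semicontinuous; this is the [v0]-reduced divisor. Dhar's burning algorithm
   then orders the vertices, i.e. gives an acyclic orientation whose divisor
   [indeg - 1] dominates it. The canonical class minus that divisor comes from
   the opposite orientation, hence is not effective either. So every
   non-effective [D] admits an effective [F] of degree [g - 1 - deg D] with
   [K - D - F] non-effective. Applied to [D - E'], with [E'] of degree [r(D) + 1]
   such that [D - E'] is non-effective, this gives
   [r(K - D) <= r(D) - deg D + g - 1]; exchanging [D] and [K - D] yields equality.

   For the bundle, an isomorphism of transition data induces an isomorphism of
   the covers, and tensoring the dual with the canonical bundle turns the class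
   [D] on the cover into [K - D]. *)

Require Import Defs.
From HB Require Import structures.
From mathcomp Require Import all_boot all_order fingroup perm all_algebra.
From mathcomp Require Import boolp reals.
From mathcomp Require Import zify ring lra.

Set Implicit Arguments.
Unset Strict Implicit.
Unset Printing Implicit Defensive.
Import Order.TTheory GRing.Theory Num.Theory.
Local Open Scope ring_scope.

(** * Floors, uniform thresholds and greedy enumerations *)

Section Preliminaries.
Variable R : realType.

Lemma pos_lower_bound (s : seq R) :
  (forall x, x \in s -> 0 < x) -> exists2 eps, 0 < eps & forall x, x \in s -> eps <= x.
Proof.
elim: s => [|a s IH] h; first by exists 1.
have [|eps e0 he] := IH; first by move=> x xs; apply: h; rewrite inE xs orbT.
have a0 : 0 < a by apply: h; rewrite inE eqxx.
exists (Num.min a eps); first by rewrite lt_min a0.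
move=> x; rewrite inE => /orP[/eqP->|/he xe]; first by rewrite ge_min lexx.
by rewrite ge_min xe orbT.
Qed.

Lemma pos_lower_bound_fin (T : finType) (f : T -> R) :
  (forall t, 0 < f t) -> exists2 eps, 0 < eps & forall t, eps <= f t.
Proof.
move=> h; have [|eps e0 he] := @pos_lower_bound (codom f); first by move=> x /codomP[t ->].
by exists eps => // t; apply/he/codom_f.
Qed.

Lemma uniform_small (T : finType) (P : T -> R -> Prop) :
  (forall t, exists2 eps, 0 < eps & forall e, e < eps -> P t e) ->
  exists2 eps, 0 < eps & forall t e, e < eps -> P t e.
Proof.
move=> h; have /boolp.choice[f hf] : forall t, exists eps, 0 < eps /\ forall e, e < eps -> P t e.
  by move=> t; have [eps e0 he] := h t; exists eps.
have [eps e0 he] := pos_lower_bound_fin (fun t => (hf t).1).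
by exists eps => // t e ee; apply: (hf t).2; apply: lt_le_trans (he t).
Qed.

Lemma ler_sumr_term (T : finType) (P : pred T) (f : T -> R) t :
  P t -> (forall u, P u -> 0 <= f u) -> f t <= \sum_(u | P u) f u.
Proof.
move=> Pt f0; rewrite (bigD1 t)//= lerDl sumr_ge0// => u /andP[Pu _]; exact: f0.
Qed.

Lemma floor_gt_subr1 (z : R) : z - 1 < (Num.floor z)%:~R.
Proof. by have := floorD1_gt z; rewrite intrD /=; lra. Qed.

Lemma floor_right_const (z : R) :
  exists2 eps, 0 < eps & forall e, e < eps -> Num.floor (z + e) <= Num.floor z.
Proof.
exists ((Num.floor z)%:~R + 1 - z).
  by have := floorD1_gt z; rewrite intrD; lra.
by move=> e he; rewrite -ltzD1 floor_lt_int intrD /=; lra.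
Qed.

(** A small move to the left costs one unit at an integer and nothing elsewhere; in the burning
    argument this is the chip a vertex pays on an edge of integral slope. *)
Lemma floor_left_drop (z : R) :
  exists2 eps, 0 < eps & forall e, e < eps ->
    Num.floor z - (z \is a Num.int)%:Z <= Num.floor (z - e).
Proof.
have := floor_le z; case: (boolP (z \is a Num.int)) => zi hz.
  exists 1 => // e he; rewrite floor_ge_int intrB /=; lra.
exists (z - (Num.floor z)%:~R).
  by move: zi; rewrite intrEfloor subr_gt0 lt_neqAle hz andbT.
by move=> e he; rewrite floor_ge_int intrB /=; lra.
Qed.

Lemma floorN_addr (z : R) :
  Num.floor (- z) = (z \is a Num.int)%:Z - 1 - Num.floor z.
Proof.
have := ceil_floor z; rewrite ceilNfloor; case: (z \is a Num.int) => /=;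
  by set a := Num.floor _; set b := Num.floor _; lia.
Qed.

(** By [floorN_addr] the left side is at most [1] minus the last term if [z] is an integer, and at
    most [0] otherwise. The remaining case, [z] integral and [b] false, forces [dx > 0], and then
    the second floor drops strictly. *)
Lemma floor_opp_le (z dx : R) (b : bool) : 0 <= dx -> (dx = 0 -> b) ->
  1 + Num.floor z + Num.floor (- z - dx) - ((z \is a Num.int) && b)%:Z <= 0.
Proof.
move=> dx0 hb; have := le_floor (_ : - z - dx <= - z); rewrite lerBlDr lerDl => /(_ dx0).
rewrite floorN_addr; have [zi|zi] := boolP (z \is a Num.int); last first.
  by set c := Num.floor z; set c' := Num.floor _; rewrite /=; clear; lia.
have [bt|bf] := boolP b.
  by set c := Num.floor z; set c' := Num.floor _; rewrite /=; clear; lia.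
have dxp : 0 < dx.
  by rewrite lt_neqAle dx0 andbT; apply: contra bf => /eqP/esym/hb.
have : Num.floor (- z - dx) < - Num.floor z.
  rewrite floor_lt_int mulrNz; move: zi; rewrite intrEfloor => /eqP->; lra.
by set c := Num.floor z; set c' := Num.floor _; rewrite /=; clear; lia.
Qed.

Lemma sum_fiber (M : nmodType) (T U : finType) (f : U -> T) (P : pred T) (F : U -> M) :
  \sum_(w | P w) \sum_(e | f e == w) F e = \sum_(e | P (f e)) F e.
Proof.
rewrite (partition_big f P)//=; apply: eq_bigr => w Pw; apply: eq_bigl => e.
by case: eqVneq => [->|]; rewrite ?Pw ?andbF.
Qed.

(** [C] is enumerated greedily from [v0], and [k] is the position in the list. It is used with [Q]
    expressing adjacency, a bounded fall of a potential, and the burning condition. *)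
Lemma grow_order (T : finType) (C : {set T}) v0 (Q : {set T} -> T -> Prop) :
  v0 \in C ->
  (forall S : {set T}, v0 \in S -> S \subset C -> S != C ->
     exists w, [/\ w \in C, w \notin S & Q S w]) ->
  exists k : T -> nat, [/\ {in C &, injective k}, k v0 = 0%N,
    forall w, w \in C -> (k w < #|C|)%N &
    forall w, w \in C -> w != v0 -> Q [set u in C | (k u < k w)%N] w].
Proof.
move=> v0C step.
have [s [us ss hd hQ]] : exists s : seq T, [/\ uniq s, [set u in s] = C, nth v0 s 0 = v0 &
    forall w, w \in s -> w != v0 -> Q [set u in take (index w s) s] w].
  have : forall n, (n < #|C|)%N -> exists s : seq T,
      [/\ uniq s /\ size s = n.+1, {subset s <= C}, nth v0 s 0 = v0, v0 \in s &
      forall w, w \in s -> w != v0 -> Q [set u in take (index w s) s] w].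
    elim=> [_|n IH ltn].
      exists [:: v0]; split=> //=; first by move=> w; rewrite inE => /eqP->.
        by rewrite inE.
      by move=> w; rewrite inE => ->.
    have [s [[us sz] sC hd v0s hQ]] := IH (ltnW ltn).
    have [| | |w [wC wS Qw]] := step [set u in s].
    - by rewrite inE.
    - by apply/subsetP => u; rewrite inE => /sC.
    - apply/eqP => e; move: ltn; rewrite -e cardsE (card_uniqP us) sz ltnn //.
    move: wS; rewrite inE => ws.
    exists (rcons s w); split.
    - by rewrite rcons_uniq ws us size_rcons sz.
    - by move=> u; rewrite mem_rcons inE => /orP[/eqP->|/sC].
    - by rewrite nth_rcons sz.
    - by rewrite mem_rcons inE v0s orbT.
    move=> u; rewrite mem_rcons inE => us'; rewrite -cats1 index_cat.
    have [u_s|u_s] := boolP (u \in s) => unv.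
      by rewrite takel_cat ?index_size//; apply: hQ.
    move: us'; rewrite (negbTE u_s) orbF => /eqP uw.
    by rewrite uw /= eqxx addn0 take_size_cat.
  move=> /(_ #|C|.-1); have C0 : (0 < #|C|)%N by apply/card_gt0P; exists v0.
  rewrite prednK// => /(_ (leqnn _)) [s [[us sz] sC hd v0s hQ]].
  exists s; split=> //; apply/eqP; rewrite eqEcard cardsE (card_uniqP us) sz leqnn andbT.
  by apply/subsetP => u; rewrite inE => /sC.
have sC : forall u, (u \in s) = (u \in C) by move=> u; rewrite -ss inE.
exists (index^~ s); split.
- by move=> u v; rewrite -!sC => hu hv e; rewrite -(nth_index v0 hu) e nth_index.
- case: s us ss hd hQ sC => [|a s] /= us ss hd hQ sC; last by rewrite hd eqxx.
  by move: v0C; rewrite -sC.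
- by move=> w wC; rewrite -ss cardsE (card_uniqP us) index_mem sC.
move=> w wC wv0; rewrite (_ : [set u in C | _] = [set u in take (index w s) s]).
  by apply: hQ; rewrite ?sC.
apply/setP => u; rewrite !inE -sC; have [us'|us'] := boolP (u \in s).
  by rewrite in_take.
by apply/esym/negP => /mem_take; apply/negP.
Qed.

End Preliminaries.

(** * Winnable classes and reduced potentials *)

Section Winnable.
Variables (R : realType) (G : model R).
Local Notation src := (@msrc R G).
Local Notation tgt := (@mtgt R G).
Local Notation len := (@mlen R G).
Local Notation V := (mV G).
Local Notation E := (mE G).
Implicit Types (C : {set V}) (d : V -> int) (p : E -> R) (x : V -> R).

(* A pair [(d, p)] is a divisor on [V] twisted by constants on the edges; see
   [div_deg] and [div_shift] for the pair of a divisor with interior chips.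
   Among the integer-slope functions that take the values [- x] at the vertices
   and leave no debt inside the edges, the best one has two consecutive slopes
   on each edge; [floor (slope e)] and [floor (- slope e)] are what it brings to
   the two ends of [e], a chip staying inside [e] if [slope e] is not an integer. *)
Definition slope p x (e : E) : R := (p e - (x (tgt e) - x (src e))) / len e.

Definition chips d p x (v : V) : int :=
  d v + \sum_(e | src e == v) Num.floor (slope p x e)
      + \sum_(e | tgt e == v) Num.floor (- slope p x e).

Definition winnable C d p := exists x, forall v, v \in C -> 0 <= chips d p x v.

Definition edge_closed C := forall e, (src e \in C) = (tgt e \in C).

(** Connectedness is stated by cuts because every use extends a proper subset of [C] across an
    edge. *)
Definition cut_connected C := forall S : {set V}, S \subset C -> S != set0 -> S != C ->
  exists e, (src e \in S) != (tgt e \in S).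

Definition edges_in C : {set E} := [set e | src e \in C].

Lemma in_edges C e : (e \in edges_in C) = (src e \in C).
Proof. by rewrite inE. Qed.

Definition valz (v : V) : int := (valence v)%:Z.

Hypothesis hpos : lengths_pos G.

Lemma valzE v : valz v = \sum_(e | src e == v) 1 + \sum_(e | tgt e == v) 1.
Proof.
by rewrite /valz /valence PoszD !sumr_const !cardsE !natz.
Qed.

Variable C : {set V}.
Hypothesis hC : edge_closed C.
Hypothesis hcut : cut_connected C.

Lemma sum_src (M : nmodType) (F : E -> M) :
  \sum_(v in C) \sum_(e | src e == v) F e = \sum_(e in edges_in C) F e.
Proof. by rewrite (sum_fiber _ (fun v => v \in C)); apply: eq_bigl => e; rewrite inE. Qed.

Lemma sum_tgt (M : nmodType) (F : E -> M) :
  \sum_(v in C) \sum_(e | tgt e == v) F e = \sum_(e in edges_in C) F e.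
Proof. by rewrite (sum_fiber _ (fun v => v \in C)); apply: eq_bigl => e; rewrite inE hC. Qed.

Section Reduced.
Variables (v0 : V) (d : V -> int) (p : E -> R).
Hypothesis v0C : v0 \in C.

(** Chips depend only on differences of [x], so the value at [v0] can be normalised; this is what
    makes pointwise lower bounds possible. *)
Definition reducible_from x :=
  x v0 = 0 /\ forall w, w \in C -> w != v0 -> 0 <= chips d p x w.

Lemma grow_connected : exists k : V -> nat,
  forall w, w \in C -> w != v0 -> exists e,
    (src e == w) && (k (tgt e) < k w)%N || (tgt e == w) && (k (src e) < k w)%N.
Proof.
pose Q (S : {set V}) w := exists e,
  (src e == w) && (tgt e \in S) || (tgt e == w) && (src e \in S).
have [|k [_ _ _ kQ]] := @grow_order _ C v0 Q v0C.
  move=> S v0S SC SnC; have S0 : S != set0 by apply/set0Pn; exists v0.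
  have [e he] := hcut SC S0 SnC.
  have [sS|sS] := boolP (src e \in S).
    exists (tgt e); split; first by rewrite -hC (subsetP SC).
      by move: he; rewrite sS; case: (_ \in S).
    by exists e; rewrite eqxx sS orbT.
  exists (src e); split => //.
    by rewrite hC (subsetP SC)//; move: he; rewrite (negbTE sS); case: (_ \in S).
  by exists e; rewrite eqxx /=; move: he; rewrite (negbTE sS); case: (_ \in S).
exists k => w wC wv0; have [e] := kQ w wC wv0.
by rewrite !inE => /orP[/and3P[/eqP<- _ h]|/and3P[/eqP<- _ h]]; exists e; rewrite eqxx h ?orbT.
Qed.

(* A potential [- T r ^ k], concave along the order [k] for small [r],
   makes every vertex but [v0] as rich as desired for [T] large. *)
Lemma reducible_ex : exists x, reducible_from x.
Proof.
have [k kQ] := grow_connected.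
pose La := \sum_e (len e)^-1; pose Le := \sum_e len e.
have iv0 e : 0 < (len e)^-1 by rewrite invr_gt0 hpos.
have La0 : 0 <= La by apply: sumr_ge0 => e _; apply: ltW.
have Le0 : 0 <= Le by apply: sumr_ge0 => e _; apply/ltW/hpos.
have LL0 := mulr_ge0 La0 Le0.
(* At [w], the edge to an earlier vertex brings at least [r ^ (k w - 1) / Le], while all edges
   together cost at most [r ^ k w * (2 * La)]. The gain wins once [2 * r * La * Le < 1]. *)
pose r : R := (1 + 2 * (La * Le))^-1.
have r0 : 0 < r by rewrite invr_gt0; lra.
have r1 : r <= 1 by rewrite invf_le1//; lra.
have rL : 2 * r * (La * Le) < 1.
  have : r * (1 + 2 * (La * Le)) = 1 by rewrite mulVf// gt_eqF//; lra.
  lra.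
pose h v : R := - r ^+ k v.
(* The Laplacian of [h]: the rate at which the sum of the slopes leaving [w] grows with the factor
   [T] below. *)
pose lap w := \sum_(e | src e == w) (h w - h (tgt e)) / len e
            + \sum_(e | tgt e == w) (h w - h (src e)) / len e.
have lap_gt0 w : w \in C -> w != v0 -> 0 < lap w.
  move=> wC wv0; have [e0 he0] := kQ w wC wv0.
  pose a w := \sum_(e | src e == w) r ^+ k (tgt e) / len e
            + \sum_(e | tgt e == w) r ^+ k (src e) / len e.
  pose b w := \sum_(e | src e == w) (len e)^-1 + \sum_(e | tgt e == w) (len e)^-1.
  have -> : lap w = a w - r ^+ k w * b w.
    rewrite /lap /a /b mulrDr !mulr_sumr opprD addrACA -!sumrB.
    by congr (_ + _); apply: eq_bigr => e _; rewrite /h; ring.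
  have bLa : b w <= 2 * La.
    have half (P : pred E) : \sum_(e | P e) (len e)^-1 <= La.
      by rewrite big_mkcond ler_sum// => e _; case: ifP => // _; apply: ltW.
    by rewrite mulr_natl mulr2n lerD.
  have ab e u : r ^+ u / len e >= 0 by rewrite mulr_ge0 ?exprn_ge0 ?ltW.
  have km : (0 < k w)%N by case/orP: he0 => /andP[_]; apply: leq_ltn_trans.
  have ra : r ^+ (k w).-1 / len e0 <= a w.
    case/orP: he0 => /andP[/eqP e0w kk].
      apply: (@le_trans _ _ (r ^+ k (tgt e0) / len e0)).
        by rewrite ler_pM2r// ler_wiXn2l // ?ltW// -ltnS prednK.
      rewrite /a -[leLHS]addr0 lerD ?sumr_ge0//.
      by apply: (ler_sumr_term (f := fun e => r ^+ k (tgt e) / len e)) => //; rewrite e0w.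
    apply: (@le_trans _ _ (r ^+ k (src e0) / len e0)).
      by rewrite ler_pM2r// ler_wiXn2l // ?ltW// -ltnS prednK.
    rewrite /a -[leLHS]add0r lerD ?sumr_ge0//.
    by apply: (ler_sumr_term (f := fun e => r ^+ k (src e) / len e)) => //; rewrite e0w.
  rewrite subr_gt0; apply: lt_le_trans ra.
  rewrite -{1}(prednK km) exprS mulrAC mulrC ltr_pM2l ?exprn_gt0//.
  apply: (@le_lt_trans _ _ (r * (2 * La))); first by rewrite ler_pM2l.
  rewrite -div1r ltr_pdivlMr//; apply: le_lt_trans rL.
  have : len e0 <= Le by apply: (ler_sumr_term (P := predT) (f := len)) => // u _; apply/ltW.
  move/(ler_wpM2l (mulr_ge0 (ltW r0) La0)); lra.
(* A lower bound for the chips at [T = 0], each floor being replaced by its argument minus one. The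
   sum defining [T] exceeds each single ratio needed to compensate a negative [c w]. *)
pose c w : R := (d w)%:~R + \sum_(e | src e == w) (p e / len e - 1)
            + \sum_(e | tgt e == w) (- (p e / len e) - 1).
pose T := \sum_(w in C :\ v0) `|c w| / lap w.
pose x v : R := T * (h v - h v0).
exists x; split; first by rewrite /x subrr mulr0.
move=> w wC wv0; rewrite -(ler0z R).
have : 0 <= c w + T * lap w.
  have : `|c w| <= T * lap w.
    rewrite -ler_pdivrMr ?lap_gt0//.
    apply: (ler_sumr_term (f := fun w => `|c w| / lap w)); first by rewrite !inE wv0.
    by move=> u; rewrite !inE => /andP[uv uC]; rewrite divr_ge0// ltW// lap_gt0.
  by have := ler_norm (- c w); rewrite normrN; lra.
move=> /le_trans; apply.
rewrite /c /lap mulrDr addrACA -addrA addrACA /chips !intrD !rmorph_sum /= -!addrA lerD2l.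
rewrite !mulr_sumr addrA -!big_split/= lerD// ler_sum// => e /eqP we.
  apply: (@le_trans _ _ (slope p x e - 1)); last exact/ltW/floor_gt_subr1.
  by rewrite /slope -we le_eqVlt; apply/orP; left; apply/eqP; rewrite /x; ring.
apply: (@le_trans _ _ (- slope p x e - 1)); last exact/ltW/floor_gt_subr1.
by rewrite /slope -we le_eqVlt; apply/orP; left; apply/eqP; rewrite /x; ring.
Qed.

(** If [x] fell by more than [Q] from a set containing [v0] to all the rest of [C], the edges of the
    cut would take more chips from the rest than [d] can supply there. So [C] can be enumerated from
    [v0] with [x] falling by at most [Q] below some earlier vertex, and the falls add up to at most
    [Q * #|C|]. *)
Lemma reducible_lbound : exists B, forall x, reducible_from x ->
  forall w, w \in C -> - B <= x w.
Proof.
(* [N] bounds the supply of [d] on any set, and a fall beyond [Q] along [e] makes the slope out of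
   the lower end less than [- N]. *)
pose N := \sum_w `|d w|; pose Q : R := \sum_e (`|p e| + N%:~R * len e).
have N0 : 0 <= N by apply: sumr_ge0.
have NR0 : (0 : R) <= N%:~R by rewrite ler0z.
have Q0 : 0 <= Q by apply: sumr_ge0 => e _; rewrite addr_ge0// mulr_ge0// ltW// hpos.
have Qe e : `|p e| + N%:~R * len e <= Q.
  apply: (@ler_sumr_term _ _ predT (fun e => `|p e| + N%:~R * len e)) => // u _.
  by rewrite addr_ge0// mulr_ge0// ltW// hpos.
exists (Q * #|C|%:R) => x [x0 hx].
have [|k [kinj k0 kC kQ]] :=
    @grow_order _ C v0 (fun S w => exists2 u, u \in S & x u - Q <= x w) v0C.
  move=> S v0S SC SnC; apply: contrapT => hS.
  have far u w : u \in S -> w \in C -> w \notin S -> x w < x u - Q.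
    move=> uS wC wS; rewrite ltNge; apply/negP => le.
    by apply: hS; exists w; split => //; exists u.
  pose A := C :\: S.
  have AC : A \subset C by apply: subsetDl.
  have A0 : A != set0.
    by apply: contra SnC; rewrite setD_eq0 => CS; rewrite eqEsubset SC.
  have AnC : A != C.
    by apply/negP => /eqP e; move: v0C; rewrite -e inE v0S.
  have AS e : e \in edges_in C ->
      (src e \in S) = (src e \notin A) /\ (tgt e \in S) = (tgt e \notin A).
    by rewrite !inE => sC; rewrite -hC sC !andbT !negbK.
  have [e0 he0] := hcut AC A0 AnC.
  have e0C : e0 \in edges_in C.
    rewrite inE; move: he0; rewrite !inE -hC.
    by case: (src e0 \in C) => //; rewrite !andbF.
  (* What [e] brings to [A] in total: less than [- N] on a cut edge, and never positive, since the
     floors of opposite numbers sum to at most zero. *)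
  pose t e : int := (if src e \in A then Num.floor (slope p x e) else 0)
                  + (if tgt e \in A then Num.floor (- slope p x e) else 0).
  have tb e : (src e \in A) != (tgt e \in A) -> t e < - N.
    move=> he; have eC : e \in edges_in C.
      rewrite inE; move: he; rewrite !inE -hC.
      by case: (src e \in C) => //; rewrite !andbF.
    have [sS tS] := AS e eC; have le0 := hpos e.
    have pe := Qe e; have pa := ler_norm (p e); have := ler_norm (- p e); rewrite normrN => pb.
    have sC : src e \in C by rewrite -in_edges.
    have tC : tgt e \in C by rewrite -hC.
    rewrite /t; case: ifP he => sA; case: ifP => tA // _.
      rewrite addr0 floor_lt_int /slope ltr_pdivrMr//.
      have := far (tgt e) (src e); rewrite sS tS sA tA sC => /(_ isT isT isT).
      rewrite mulrNz; lra.
    rewrite add0r floor_lt_int /slope -mulNr ltr_pdivrMr//.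
    have := far (src e) (tgt e); rewrite sS tS sA tA tC => /(_ isT isT isT).
    rewrite mulrNz; lra.
  have t0 e : t e <= 0.
    have [he|] := eqVneq (src e \in A) (tgt e \in A); last first.
      by move/tb/ltW/le_trans; apply; rewrite oppr_le0.
    rewrite /t he; case: ifP => _ //; rewrite floorN_addr.
    by set a := Num.floor _; case: (slope p x e \is a Num.int) => /=; clear; lia.
  have : 0 <= \sum_(w in A) chips d p x w.
    apply: sumr_ge0 => w; rewrite inE => /andP[wS wC]; apply: hx => //.
    by apply: contra wS => /eqP->.
  rewrite /chips !big_split /= !(sum_fiber _ (fun v => v \in A)) /=.
  rewrite -addrA => hh.
  have dN : \sum_(w in A) d w <= N.
    rewrite /N big_mkcond; apply: ler_sum => w _; case: ifP => _ //; exact: ler_norm.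
  have tN : \sum_e t e < - N.
    rewrite (bigD1 e0)//=; have := tb _ he0.
    have : \sum_(e | e != e0) t e <= 0 by apply: sumr_le0.
    by move=> h1 h2; rewrite -[- N]addr0 ltr_leD.
  have : \sum_e t e = \sum_(e | src e \in A) Num.floor (slope p x e)
      + \sum_(e | tgt e \in A) Num.floor (- slope p x e).
    by rewrite /t big_split -!big_mkcond.
  move=> tE; rewrite -tE in hh.
  by have := ler_ltD dN tN; rewrite subrr => /(le_lt_trans hh); rewrite ltxx.
have step n w : w \in C -> (k w <= n)%N -> - (Q * n%:R) <= x w.
  elim: n w => [|n IH] w wC kn.
    have -> : w = v0 by apply: kinj => //; rewrite k0; apply/eqP; rewrite -leqn0.
    by rewrite x0 mulr0 oppr0.
  have [->|wv0] := eqVneq w v0.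
    by rewrite x0 oppr_le0 mulr_ge0.
  have [u] := kQ w wC wv0; rewrite inE => /andP[uC ku] hu.
  have := IH u uC; rewrite -natr1 -ltnS => /(_ (leq_trans ku kn)); lra.
by move=> w wC; apply: step => //; apply/ltnW/kC.
Qed.

Definition reduced_from x :=
  reducible_from x /\ forall y, reducible_from y -> forall w, w \in C -> x w <= y w.

(* Right-continuity of [floor] makes the pointwise infimum admissible. *)
Lemma reduced_ex : exists x, reduced_from x.
Proof.
pose M w : classical_sets.set R := fun t => exists2 y, reducible_from y & y w = t.
have [B hB] := reducible_lbound; have [y0 hy0] := reducible_ex.
have Minf w : w \in C -> classical_sets.has_inf (M w).
  move=> wC; split; first by exists (y0 w), y0.
  by exists (- B) => t [y hy <-]; apply: hB.
pose x w := inf (M w).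
have xle y w : reducible_from y -> w \in C -> x w <= y w.
  by move=> hy wC; apply: ge_inf; [exact: (Minf w wC).2 | exists y].
exists x; split=> [|y hy w wC]; last exact: xle.
split.
  apply/eqP; rewrite eq_le; apply/andP; split; first by rewrite -hy0.1 xle.
  by apply: lb_le_inf; [exact: (Minf v0 v0C).1 | move=> t [y [<- _] <-]].
move=> w wC wv0.
have [|eps e0 he] := @uniform_small R E (fun e t =>
    Num.floor (slope p x e + t / len e) <= Num.floor (slope p x e) /\
    Num.floor (- slope p x e + t / len e) <= Num.floor (- slope p x e)).
  move=> e; have hl := hpos e; have [e1 e1p h1] := floor_right_const (slope p x e).
  have [e2 e2p h2] := floor_right_const (- slope p x e).
  exists (Num.min e1 e2 * len e); first by rewrite mulr_gt0// lt_min e1p.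
  by move=> t; rewrite -ltr_pdivrMr// lt_min => /andP[/h1 ? /h2].
(* It is enough that [y] be close to the infimum at [w]: at the neighbours [x <= y], which only
   makes the slopes of [y] out of [w] smaller. Those slopes thus exceed the ones of [x] by less than
   [eps / len e]. *)
have [t [y hy <-] yx] := inf_adherent e0 (Minf w wC).
have {}yx : y w - x w < eps by rewrite ltrBlDl.
have vC e : src e \in C -> x (src e) <= y (src e) /\ x (tgt e) <= y (tgt e).
  by move=> sC; split; apply: xle => //; rewrite -hC.
apply: le_trans (hy.2 w wC wv0) _; rewrite /chips lerD// ?lerD// ler_sum// => e /eqP we.
  apply: le_trans (he e _ yx).1; rewrite le_floor// /slope -mulrDl ler_pM2r ?invr_gt0//.
  by rewrite -we in wC *; have [_] := vC e wC; lra.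
apply: le_trans (he e _ yx).2; rewrite le_floor// /slope -!mulNr -mulrDl ler_pM2r ?invr_gt0//.
by rewrite -we -hC in wC *; have [+ _] := vC e wC; lra.
Qed.

Definition b2z (b : bool) : int := (b : nat)%:Z.

(* Dhar's burning: fire spreads from [v0] along the edges whose slope is
   integral, that is, which carry no chip in their interior. *)
Lemma burning_order x : ~ winnable C d p -> reduced_from x ->
  exists k : V -> nat, {in C &, injective k} /\
    forall w, w \in C -> chips d p x w <
      \sum_(e | src e == w) b2z ((slope p x e \is a Num.int) && (k (tgt e) < k w)%N)
    + \sum_(e | tgt e == w) b2z ((slope p x e \is a Num.int) && (k (src e) < k w)%N).
Proof.
move=> nwin [[x0 hx] xmin].
pose cnt (S : {set V}) w :=
      \sum_(e | src e == w) b2z ((slope p x e \is a Num.int) && (tgt e \in S))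
    + \sum_(e | tgt e == w) b2z ((slope p x e \is a Num.int) && (src e \in S)).
have [|k [kinj k0 kC kQ]] := @grow_order _ C v0 (fun S w => chips d p x w < cnt S w) v0C.
  move=> S v0S SC SnC; apply: contrapT => hS.
  have rich w : w \in C -> w \notin S -> cnt S w <= chips d p x w.
    move=> wC wS; rewrite leNgt; apply/negP => lt; apply: hS; by exists w.
  have [|eps e0 he] := @uniform_small R E (fun e t =>
      Num.floor (slope p x e) - b2z (slope p x e \is a Num.int)
        <= Num.floor (slope p x e - t / len e) /\
      Num.floor (- slope p x e) - b2z (slope p x e \is a Num.int)
        <= Num.floor (- slope p x e - t / len e)).
    move=> e; have hl := hpos e; have [e1 e1p h1] := floor_left_drop (slope p x e).
    have [e2 e2p h2] := floor_left_drop (- slope p x e).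
    exists (Num.min e1 e2 * len e); first by rewrite mulr_gt0// lt_min e1p.
    by move=> t; rewrite -ltr_pdivrMr// lt_min => /andP[/h1 ? /h2]; rewrite rpredN.
  pose t := eps / 2; have t0 : 0 < t by rewrite /t; lra.
  have te : t < eps by rewrite /t; lra.
  (* If the fire stops at [S], lowering [x] slightly on the unburnt vertices creates no new debt:
     each of them loses at most one chip per burning edge and can afford it by [rich]. This
     contradicts the minimality of [x]. *)
  pose x' w := x w - (if w \in C :\: S then t else 0).
  have x'le w : x' w <= x w by rewrite /x'; case: ifP => _; lra.
  have x'S w : w \in S -> x' w = x w by move=> wS; rewrite /x' inE wS subr0.
  have x'A w : w \in C -> w \notin S -> x' w = x w - t by move=> wC wS; rewrite /x' inE wS wC.
  have red : reducible_from x'.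
    split=> [|w wC wv0]; first by rewrite x'S.
    have [wS|wS] := boolP (w \in S).
      apply: le_trans (hx w wC wv0) _; rewrite /chips lerD// ?lerD// ler_sum// => e /eqP we.
        rewrite le_floor// /slope we (x'S w wS) ler_pM2r ?invr_gt0//.
        by have := x'le (tgt e); lra.
      rewrite le_floor// /slope we (x'S w wS) -!mulNr ler_pM2r ?invr_gt0//.
      by have := x'le (src e); lra.
    have := rich w wC wS; rewrite -subr_ge0 => /le_trans; apply.
    have -> : chips d p x w - cnt S w = d w
        + \sum_(e | src e == w) (Num.floor (slope p x e)
            - b2z ((slope p x e \is a Num.int) && (tgt e \in S)))
        + \sum_(e | tgt e == w) (Num.floor (- slope p x e)
            - b2z ((slope p x e \is a Num.int) && (src e \in S))).
      by rewrite /chips /cnt !sumrB; ring.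
    rewrite /chips lerD// ?lerD// ler_sum// => e /eqP we.
      have tC : tgt e \in C by rewrite -hC we.
      have [tS|tS] := boolP (tgt e \in S); last first.
        rewrite andbF subr0 le_floor// /slope we (x'A _ wC wS) (x'A _ tC tS).
        by rewrite ler_pM2r ?invr_gt0//; lra.
      rewrite andbT; apply: le_trans (he e _ te).1 _.
      rewrite le_floor// /slope we (x'A _ wC wS) (x'S _ tS).
      by rewrite -mulrBl ler_pM2r ?invr_gt0//; lra.
    have sC : src e \in C by rewrite hC we.
    have [tS|tS] := boolP (src e \in S); last first.
      rewrite andbF subr0 le_floor// /slope we (x'A _ wC wS) (x'A _ sC tS).
      by rewrite -!mulNr ler_pM2r ?invr_gt0//; lra.
    rewrite andbT; apply: le_trans (he e _ te).2 _.
    rewrite le_floor// /slope we (x'A _ wC wS) (x'S _ tS).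
    by rewrite -!mulNr -mulrDl ler_pM2r ?invr_gt0//; lra.
  have /subsetPn[w wC wS] : ~~ (C \subset S).
    by apply: contra SnC => CS; rewrite eqEsubset SC.
  by have := xmin x' red w wC; rewrite x'A//; lra.
exists k; split=> // w wC.
have [->|wv0] := eqVneq w v0.
  (* At [v0] the bound comes from the debt: without it [x] itself would win. *)
  apply: (@lt_le_trans _ _ 0); last by rewrite addr_ge0// sumr_ge0.
  rewrite ltNge; apply/negP => c0; apply: nwin; exists x => u uC.
  by have [->|] := eqVneq u v0; last exact: hx.
apply: lt_le_trans (kQ w wC wv0) _.
rewrite /cnt lerD// ler_sum// => e _; rewrite inE.
  by case: (_ \is a _) => //=; case: (tgt e \in C).
by case: (_ \is a _) => //=; case: (src e \in C).
Qed.

End Reduced.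
End Winnable.

(** * Riemann-Roch on a component *)

Section RiemannRoch.
Variables (R : realType) (G : model R).
Local Notation src := (@msrc R G).
Local Notation tgt := (@mtgt R G).
Local Notation len := (@mlen R G).
Local Notation V := (mV G).
Local Notation E := (mE G).
Implicit Types (C : {set V}) (d : V -> int) (p : E -> R) (x : V -> R).

Hypothesis hpos : lengths_pos G.
Hypothesis hloop : forall e, src e != tgt e.

Lemma chipsE d p x v f : slope p x =1 f ->
  chips d p x v = d v + \sum_(e | src e == v) Num.floor (f e)
                + \sum_(e | tgt e == v) Num.floor (- f e).
Proof. by move=> h; rewrite /chips; congr (_ + _ + _); apply: eq_bigr => e _; rewrite h. Qed.

Section Component.
Variable C : {set V}.
Hypothesis hC : edge_closed C.
Hypothesis hcut : cut_connected C.

(** Ties between minima are broken by [k], so that any neighbour of [v] at the same height comes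
    earlier in the order, and the edge to it is oriented towards [v]. *)
Lemma last_min_ex (x : V -> R) (k : V -> nat) v0 : v0 \in C -> exists2 v, v \in C &
  forall u, u \in C -> x v <= x u /\ (x u = x v -> (k u <= k v)%N).
Proof.
move=> v0C; case: (arg_minP x v0C) => m mC mmin.
case: (@arg_maxnP _ m (fun u => (u \in C) && (x u == x m)) k _); first by rewrite eqxx andbT.
move=> v /andP[vC /eqP xv] vmax.
exists v => // u uC; rewrite xv; split; first exact: mmin.
by move=> xu; apply: vmax; rewrite /= uC xu eqxx.
Qed.

(* With [x] reduced and [k] the burning order, [d + F] is the divisor
   [indeg - 1] of the orientation along [k] (towards the chip on the edges of
   non-integral slope); its complement in the canonical class is the divisor of
   the opposite orientation. *)
Lemma unwinnable_complement v0 d p : v0 \in C -> ~ winnable C d p ->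
  exists F : V -> int, [/\ forall v, 0 <= F v,
    \sum_(v in C) F v = #|edges_in C|%:Z - #|C|%:Z - \sum_(v in C) d v &
    ~ winnable C (fun v => valz v - 2 - d v - F v) (fun e => - p e)].
Proof.
move=> v0C nwin.
have [xs xred] := reduced_ex hpos hC hcut d p v0C.
have [k [kinj hk]] := burning_order hpos hC v0C nwin xred.
pose y e := slope p xs e.
pose bs e := b2z ((y e \is a Num.int) && (k (tgt e) < k (src e))%N).
pose bt e := b2z ((y e \is a Num.int) && (k (src e) < k (tgt e))%N).
pose cnt w := \sum_(e | src e == w) bs e + \sum_(e | tgt e == w) bt e.
have {}hk w : w \in C -> chips d p xs w < cnt w.
  by move/hk/lt_le_trans; apply; rewrite /cnt lerD// ler_sum// => e /eqP<-.
(* On [C] this raises the chips of [xs] to exactly [cnt v - 1]; strictness in [hk] makes it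
   nonnegative. *)
pose F v := if v \in C then -1 - chips d p xs v + cnt v else 0.
exists F; split.
- by move=> v; rewrite /F; case: ifP => // /hk; set a := chips _ _ _ _; set b := cnt _; clear; lia.
- rewrite (eq_bigr (fun v => - 1 - d v + (\sum_(e | src e == v) (bs e - Num.floor (y e))
      + \sum_(e | tgt e == v) (bt e - Num.floor (- y e))))); last first.
    by move=> v vC; rewrite /F vC /cnt /chips !sumrB -/y; ring.
  rewrite !big_split/= (sum_src C) (sum_tgt hC) -[X in _ + X]big_split/= !sumrN sumr_const.
  (* Each edge counts once: at integral slope the floors cancel and exactly one of [bs], [bt] is
     [1]; otherwise both vanish and the floors sum to [-1]. *)
  have -> : \sum_(e in edges_in C) (bs e - Num.floor (y e) + (bt e - Num.floor (- y e)))
      = #|edges_in C|%:Z; last by rewrite natz; ring.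
  rewrite -natz -sumr_const; apply: eq_bigr.
  move=> e; rewrite in_edges => sC; have tC : tgt e \in C by rewrite -hC.
  have kne : k (src e) != k (tgt e).
    by apply: contra (hloop e) => /eqP /(kinj _ _ sC tC)->.
  rewrite floorN_addr /bs /bt; set a := Num.floor _.
  by case: (y e \is a Num.int); case: ltngtP kne; rewrite /b2z /=; clear; lia.
move=> [x hx].
(* A potential [x] winning for the complement is compared with [xs]: its slopes are those of [- y]
   corrected by differences of [x']. At the last minimum of [x'] all corrections have the sign
   required by [floor_opp_le], so that vertex keeps a debt of at least one. *)
pose x' v := x v + xs v.
have [v vC vmin] := last_min_ex x' k v0C.
have := hx v vC; rewrite leNgt => /negP; apply.
have -> : chips (fun v => valz v - 2 - d v - F v) (fun e => - p e) x v =
  - 1 + (\sum_(e | src e == v) (1 + Num.floor (y e) + Num.floor (slope (fun e => - p e) x e) - bs e)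
   + \sum_(e | tgt e == v) (1 + Num.floor (- y e) + Num.floor (- slope (fun e => - p e) x e) - bt e)).
  by rewrite !sumrB !big_split/= {1}/chips /F vC /cnt {1}/chips -/y valzE; ring.
have dropN e : slope (fun e => - p e) x e = - y e - (x' (tgt e) - x' (src e)) / len e.
  by rewrite /y /slope /x'; ring.
rewrite -[ltRHS]addr0 ltr_leD// -[leRHS]addr0 lerD// sumr_le0// => e /eqP we.
  rewrite dropN /bs /b2z; apply: floor_opp_le.
    by apply: divr_ge0; [rewrite subr_ge0 we (vmin _ _).1// | exact: ltW]; rewrite -hC we.
  move/eqP; rewrite mulf_eq0 invr_eq0 (gt_eqF (hpos e)) orbF subr_eq0 => /eqP.
  rewrite we => xe; rewrite ltn_neqAle (vmin _ _).2// -?hC ?we// andbT.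
  by apply: contra (hloop e) => /eqP/kinj->; rewrite ?we// -hC we.
have -> : - slope (fun e => - p e) x e = - (- y e) - (x' (src e) - x' (tgt e)) / len e.
  by rewrite dropN; ring.
rewrite /bt /b2z -rpredN; apply: floor_opp_le.
  by apply: divr_ge0; [rewrite subr_ge0 we (vmin _ _).1// | exact: ltW]; rewrite hC we.
move/eqP; rewrite mulf_eq0 invr_eq0 (gt_eqF (hpos e)) orbF subr_eq0 => /eqP.
rewrite we => xe; rewrite ltn_neqAle (vmin _ _).2// ?hC ?we// andbT.
by apply: contra (hloop e) => /eqP/kinj->; rewrite ?we// hC we.
Qed.

Lemma winnable_mono d p d' p' : (forall v, v \in C -> d v <= d' v) ->
  (forall e, src e \in C -> p e = p' e) -> winnable C d p -> winnable C d' p'.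
Proof.
move=> hd hp [x hx]; exists x => v vC; apply: le_trans (hx v vC) _.
rewrite /chips !lerD ?hd// ler_sum// => e /eqP we; rewrite /slope hp// ?we//.
by rewrite hC we.
Qed.

(* [K e] is the number of chips inside [e] and [p e] the sum of their distances
   to the target of [e]. *)
Definition effective_class d p := exists K : E -> int,
  (forall e, src e \in C -> 0 <= p e <= (K e)%:~R * len e) /\
  (forall v, v \in C -> \sum_(e | tgt e == v) K e <= d v).

(** The same potential wins: [p'] can only raise the floor at the source of [e], and it lowers the
    one at the target by at most [K e], which [d'] pays for. *)
Lemma winnable_add_effective d p d' p' : winnable C d p -> effective_class d' p' ->
  winnable C (fun v => d v + d' v) (fun e => p e + p' e).
Proof.
move=> [x hx] [K [Kp Kd]]; exists x => v vC; apply: le_trans (hx v vC) _.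
have sl e : slope (fun e => p e + p' e) x e = slope p x e + p' e / len e.
  by rewrite /slope; ring.
have -> : chips (fun v => d v + d' v) (fun e => p e + p' e) x v =
    d v + (d' v - \sum_(e | tgt e == v) K e)
    + \sum_(e | src e == v) Num.floor (slope p x e + p' e / len e)
    + \sum_(e | tgt e == v) (Num.floor (- slope p x e - p' e / len e) + K e).
  rewrite (chipsE _ _ sl) big_split /=.
  by under [X in _ + X = _]eq_bigr => e _ do rewrite opprD; ring.
rewrite {1}/chips lerD// ?lerD// ?lerDl ?subr_ge0 ?Kd// ler_sum// => e /eqP we.
  have /andP[p0 _] : 0 <= p' e <= (K e)%:~R * len e by apply: Kp; rewrite we.
  by rewrite le_floor// lerDl divr_ge0// ltW.
have /andP[_ pK] : 0 <= p' e <= (K e)%:~R * len e by apply: Kp; rewrite hC we.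
rewrite -lerBlDr floor_ge_int intrB; move: pK; rewrite -ler_pdivrMr//.
by have := floor_le (- slope p x e); lra.
Qed.

(* [r + 1] is the least degree of an effective class whose subtraction makes
   [(d, p)] unwinnable; testing the lower bound on vertex divisors suffices,
   since [unwinnable_complement] produces one. *)
Definition has_rank d p (r : int) :=
  (exists d' p', [/\ effective_class d' p', \sum_(v in C) d' v = r + 1 &
     ~ winnable C (fun v => d v - d' v) (fun e => p e - p' e)]) /\
  (forall F : V -> int, (forall v, 0 <= F v) -> \sum_(v in C) F v <= r ->
     winnable C (fun v => d v - F v) p).

End Component.

(* Equality of classes in [H^1(G, H)]: linear equivalence read on pairs [(d, p)]. *)
Definition class_eq d p d' p' := exists (c : V -> R) (s : E -> int),
  (forall v, d v - d' v = \sum_(e | src e == v) s e - \sum_(e | tgt e == v) s e) /\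
  (forall e, p e - p' e = c (tgt e) - c (src e) - (s e)%:~R * len e).

Lemma class_eq_sym d p d' p' : class_eq d p d' p' -> class_eq d' p' d p.
Proof.
move=> [c [s [hd hp]]]; exists (fun v => - c v), (fun e => - s e); split=> [v|e].
  by rewrite !sumrN -opprB hd; ring.
by rewrite -opprB hp mulrNz; ring.
Qed.

Lemma class_eq_add d p d' p' a b a' b' : class_eq d p d' p' -> class_eq a b a' b' ->
  class_eq (fun v => d v + a v) (fun e => p e + b e)
           (fun v => d' v + a' v) (fun e => p' e + b' e).
Proof.
move=> [c [s [hd hp]]] [c' [s' [hd' hp']]].
exists (fun v => c v + c' v), (fun e => s e + s' e); split=> [v|e].
  by rewrite opprD addrACA hd hd' !big_split /=; ring.
by rewrite opprD addrACA hp hp' intrD; ring.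
Qed.

Lemma class_eq_refl d p d' p' : d =1 d' -> p =1 p' -> class_eq d p d' p'.
Proof.
move=> hd hp; exists (fun=> 0), (fun=> 0); split=> [v|e].
  by rewrite hd !subrr !big1// subrr.
by rewrite hp !subrr mul0r subrr.
Qed.

(** Translating the potential by [c] changes every slope by the integer [s e], which passes through
    both floors exactly. *)
Lemma winnable_class_eq C d p d' p' :
  class_eq d p d' p' -> winnable C d p -> winnable C d' p'.
Proof.
move=> [c [s [hd hp]]] [x hx]; exists (fun v => x v - c v) => v vC.
apply: le_trans (hx v vC) _.
have sl e : slope p' (fun v => x v - c v) e = slope p x e + (s e)%:~R.
  have l0 : len e != 0 by rewrite gt_eqF.
  rewrite /slope; have -> : p' e = p e - (p e - p' e) by ring.
  by rewrite hp; field.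
have hdv : d v = d' v + (\sum_(e | src e == v) s e - \sum_(e | tgt e == v) s e).
  by rewrite -hd; ring.
rewrite (chipsE _ _ sl) (eq_bigr (fun e => Num.floor (slope p x e) + s e)); last first.
  by move=> e _; rewrite floorDrz ?intr_int// intrKfloor.
rewrite [X in _ <= _ + X](eq_bigr (fun e => Num.floor (- slope p x e) - s e)); last first.
  by move=> e _; rewrite opprD -mulrNz floorDrz ?intr_int// intrKfloor.
rewrite /chips [in leLHS]/= hdv !big_split/= sumrN le_eqVlt; apply/orP; left; apply/eqP; ring.
Qed.

Lemma has_rank_class_eq C d p d' p' r :
  class_eq d p d' p' -> has_rank C d p r -> has_rank C d' p' r.
Proof.
move=> h [[a [b [ab sa nw]]] hF]; split.
  exists a, b; split=> // hw; apply: nw; apply: winnable_class_eq hw.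
  exact: class_eq_add (class_eq_sym h) (class_eq_refl (fun=> erefl) (fun=> erefl)).
move=> F F0 Fr; have := hF F F0 Fr; apply: winnable_class_eq.
move: h => [c [s [hd hp]]]; exists c, s; split=> // v.
by rewrite opprB addrA subrK hd.
Qed.

End RiemannRoch.

(** * Disconnected graphs *)

Section TotalRank.
Variables (R : realType) (G : model R).
Local Notation src := (@msrc R G).
Local Notation tgt := (@mtgt R G).
Local Notation len := (@mlen R G).
Local Notation V := (mV G).
Local Notation E := (mE G).
Implicit Types (C : {set V}) (d : V -> int) (p : E -> R) (x : V -> R).

Lemma class_eq_sum C d p d' p' : edge_closed C -> class_eq d p d' p' ->
  \sum_(v in C) d v = \sum_(v in C) d' v.
Proof.
move=> hC [c [s [hd _]]]; apply/eqP; rewrite -subr_eq0 -sumrB.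
by rewrite (eq_bigr _ (fun v _ => hd v)) sumrB (sum_src C) (sum_tgt hC) subrr.
Qed.

Lemma sum_valz C : edge_closed C -> \sum_(v in C) valz v = #|edges_in C|%:Z *+ 2.
Proof.
move=> hC; rewrite (eq_bigr _ (fun v _ => valzE v)) big_split/= (sum_src C) (sum_tgt hC).
by rewrite sumr_const natz.
Qed.

(** The canonical divisor has chips at vertices only, hence the zero shift. *)
Definition canonical_class_eq d p := class_eq d p (fun v => valz v - 2) (fun=> 0).

Section OneComponent.
Hypothesis hpos : lengths_pos G.
Hypothesis hloop : forall e, src e != tgt e.
Variables (C : {set V}) (v0 : V).
Hypothesis hC : edge_closed C.
Hypothesis hcut : cut_connected C.
Hypothesis v0C : v0 \in C.

(** One half of Riemann-Roch, with [g - 1] in the form [#|edges_in C| - #|C|]. Were it false, [r2]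
    would reach the degree of the [F] given by [unwinnable_complement]. *)
Lemma rank_ineq d1 p1 r1 d2 p2 r2 : has_rank C d1 p1 r1 -> has_rank C d2 p2 r2 ->
  canonical_class_eq (fun v => d1 v + d2 v) (fun e => p1 e + p2 e) ->
  r2 <= r1 - \sum_(v in C) d1 v + #|edges_in C|%:Z - #|C|%:Z.
Proof.
move=> [[a [b [ab sa nw]]] _] [_ hF] hK.
have [F [F0 sF nwF]] := unwinnable_complement hpos hloop hC hcut v0C nw.
rewrite sumrB sa in sF.
rewrite leNgt; apply/negP => lt; apply: nwF.
have /hF w2 : \sum_(v in C) F v <= r2.
  rewrite sF; move: lt; set s := \sum_(v in C) d1 v.
  by set m := #|edges_in C|%:Z; set n := #|C|%:Z; clear; lia.
have {}w2 := w2 F0.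
have w3 : winnable C (fun v => valz v - 2 - d1 v - F v) (fun e => - p1 e).
  apply: winnable_class_eq w2 => //.
  have := class_eq_add hK (class_eq_refl (fun v => erefl (- d1 v - F v)) (fun e => erefl (- p1 e))).
  move=> [c [s [hd hp]]]; exists c, s; split=> [v|e]; first by rewrite -hd; ring.
  by rewrite -hp; ring.
(* Adding back the effective class [(a, b)] turns the canonical class minus [(d1, p1)] minus [F]
   into the class that [nwF] declares unwinnable. *)
apply: winnable_mono (winnable_add_effective hpos hC w3 ab) => // [v _|e _] /=.
  by rewrite le_eqVlt; apply/orP; left; apply/eqP; ring.
by ring.
Qed.

End OneComponent.

(** The inequalities for the two orders of the classes are opposite to each other, because the
    degrees sum to [2 * (#|edges_in C| - #|C|)]. *)
Lemma component_riemann_roch C v0 d1 p1 r1 d2 p2 r2 :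
  lengths_pos G -> (forall e, src e != tgt e) ->
  edge_closed C -> cut_connected C -> v0 \in C ->
  has_rank C d1 p1 r1 -> has_rank C d2 p2 r2 ->
  canonical_class_eq (fun v => d1 v + d2 v) (fun e => p1 e + p2 e) ->
  r1 - r2 = \sum_(v in C) d1 v + #|C|%:Z - #|edges_in C|%:Z.
Proof.
move=> hpos hloop hC hcut v0C h1 h2 hK.
have le1 := rank_ineq hpos hloop hC hcut v0C h1 h2 hK.
have := rank_ineq hpos hloop hC hcut v0C h2 h1.
have hK' : canonical_class_eq (fun v => d2 v + d1 v) (fun e => p2 e + p1 e).
  by case: hK => c [s [hd hp]]; exists c, s; split=> [v|e]; rewrite -?hd -?hp; ring.
move=> /(_ hK') le2; have := class_eq_sum hC hK.
rewrite big_split sumrB sum_valz//= sumr_const.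
move: le1 le2; set s1 := \sum_(v in C) d1 v; set s2 := \sum_(v in C) d2 v.
set m := #|edges_in C|%:Z; rewrite -[2 *+ _]mulr_natr natz; set n := #|C|%:Z.
by rewrite mulr2n; clear; lia.
Qed.

Lemma adjV_sym : connect_sym (@adjV R G).
Proof.
by apply: sym_connect_sym => x y; apply: eq_existsb => e; rewrite orbC.
Qed.

Lemma mem_compo C v : C \in components G -> (v \in C) = (compo v == C).
Proof.
move=> /imsetP[x _ ->]; apply/idP/eqP => [|<-]; last by rewrite inE.
rewrite inE => xv; apply/setP => u; rewrite !inE.
by rewrite (same_connect adjV_sym xv).
Qed.

Lemma compo_components v : compo v \in components G.
Proof. exact: imset_f. Qed.

Lemma component_edge_closed C : C \in components G -> edge_closed C.
Proof.
move=> /imsetP[x _ ->] e; rewrite !inE.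
by apply/same_connect_r/connect1; [exact: adjV_sym | apply/existsP; exists e; rewrite !eqxx].
Qed.

Lemma component_cut_connected C : C \in components G -> cut_connected C.
Proof.
move=> CG S SC /set0Pn[u uS] SnC; apply: contrapT => h.
have cl : closed (@adjV R G) S.
  move=> x y /existsP[e he]; have : (src e \in S) = (tgt e \in S).
    by apply/eqP/negPn/negP => he'; apply: h; exists e.
  by case/orP: he => /andP[/eqP-> /eqP->].
case/negP: SnC; rewrite eqEsubset SC; apply/subsetP => w wC.
move: (wC) (subsetP SC _ uS); rewrite !(mem_compo _ CG) => /eqP wE /eqP uE.
have : w \in compo u by rewrite (mem_compo _ (compo_components u)) wE uE.
by rewrite inE => /(closed_connect cl)<-.
Qed.

Lemma component_neq0 C : C \in components G -> exists v, v \in C.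
Proof. by move=> /imsetP[x _ ->]; exists x; rewrite inE. Qed.

Lemma sum_components (f : V -> int) :
  \sum_(C in components G) \sum_(v in C) f v = \sum_v f v.
Proof.
rewrite [RHS](partition_big (@compo R G) (mem (components G)))/=; last first.
  by move=> v _; apply: compo_components.
by apply: eq_bigr => C CG; apply: eq_bigl => v; rewrite mem_compo.
Qed.

Definition total_rank d p (r : int) := exists rc : {set V} -> int,
  (forall C, C \in components G -> has_rank C d p (rc C)) /\
  r = \sum_(C in components G) rc C + #|components G|%:Z - 1.

Lemma total_rank_class_eq d p d' p' r : lengths_pos G ->
  class_eq d p d' p' -> total_rank d p r -> total_rank d' p' r.
Proof.
move=> hpos h [rc [hr ->]]; exists rc; split=> // C /hr; exact: has_rank_class_eq.
Qed.

Theorem class_riemann_roch d1 p1 r1 d2 p2 r2 :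
  lengths_pos G -> (forall e, src e != tgt e) ->
  total_rank d1 p1 r1 -> total_rank d2 p2 r2 ->
  canonical_class_eq (fun v => d1 v + d2 v) (fun e => p1 e + p2 e) ->
  r1 - r2 = \sum_v d1 v + euler_char G.
Proof.
move=> hpos hloop [rc1 [h1 ->]] [rc2 [h2 ->]] hK.
transitivity (\sum_(C in components G) (rc1 C - rc2 C)); first by rewrite sumrB; ring.
(* Vertex and edge counts are written as sums over vertices, an edge being counted at its source, so
   that [sum_components] applies to all three terms. *)
rewrite (eq_bigr (fun C => \sum_(v in C) d1 v + \sum_(v in C) 1
    - \sum_(v in C) \sum_(e | src e == v) 1)); last first.
  move=> C CG; have [v0 v0C] := component_neq0 CG.
  rewrite (component_riemann_roch hpos hloop (component_edge_closed CG)
    (component_cut_connected CG) v0C (h1 _ CG) (h2 _ CG) hK).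
  by rewrite (sum_src C) !sumr_const !natz.
rewrite sumrB big_split/= !sum_components (sum_fiber _ predT)/= !sumr_const !natz.
by rewrite /euler_char addrA.
Qed.

End TotalRank.

(** * Isomorphisms of models *)

Section Isomorphisms.
Variables (R : realType) (G H : model R).

Record model_iso (fV : mV G -> mV H) (fE : mE G -> mE H) : Prop := ModelIso {
  iso_bijV : bijective fV;
  iso_bijE : bijective fE;
  iso_src : forall e, msrc (fE e) = fV (msrc e);
  iso_tgt : forall e, mtgt (fE e) = fV (mtgt e);
  iso_len : forall e, mlen (fE e) = mlen e }.

Variables (fV : mV G -> mV H) (fE : mE G -> mE H).
Hypothesis hf : model_iso fV fE.
Implicit Type C : {set mV G}.

Lemma sum_src_iso (M : nmodType) (F : mE H -> M) v :
  \sum_(e | msrc e == fV v) F e = \sum_(e | msrc e == v) F (fE e).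
Proof.
rewrite (reindex fE) /=; last exact/onW_bij/(iso_bijE hf).
by apply: eq_bigl => e; rewrite (iso_src hf) (bij_eq (iso_bijV hf)).
Qed.

Lemma sum_tgt_iso (M : nmodType) (F : mE H -> M) v :
  \sum_(e | mtgt e == fV v) F e = \sum_(e | mtgt e == v) F (fE e).
Proof.
rewrite (reindex fE) /=; last exact/onW_bij/(iso_bijE hf).
by apply: eq_bigl => e; rewrite (iso_tgt hf) (bij_eq (iso_bijV hf)).
Qed.

Lemma chips_iso d p (x : mV H -> R) v :
  chips (d \o fV) (p \o fE) (x \o fV) v = chips d p x (fV v).
Proof.
rewrite /chips sum_src_iso sum_tgt_iso.
by congr (_ + _ + _); apply: eq_bigr => e _; rewrite /slope /= (iso_src hf) (iso_tgt hf) (iso_len hf).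
Qed.

Lemma winnable_iso C d p :
  winnable (fV @: C) d p <-> winnable C (d \o fV) (p \o fE).
Proof.
split=> -[x hx].
  by exists (x \o fV) => v vC; rewrite chips_iso; apply/hx/imset_f.
have [g fK gK] := iso_bijV hf.
exists (x \o g) => _ /imsetP[v vC ->]; rewrite -chips_iso.
rewrite (_ : _ \o fV = x); first exact: hx.
by apply: boolp.funext => u /=; rewrite fK.
Qed.

Lemma sum_imset_iso (M : nmodType) C (F : mV H -> M) :
  \sum_(v in fV @: C) F v = \sum_(v in C) F (fV v).
Proof. by rewrite big_imset//= => u v _ _; apply: (bij_inj (iso_bijV hf)). Qed.

Lemma has_rank_iso C d p r : has_rank (fV @: C) d p r -> has_rank C (d \o fV) (p \o fE) r.
Proof.
have fI := bij_inj (iso_bijV hf).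
move=> [[a [b [[K [Kb Ka]] sa nw]]] hF]; split.
  exists (a \o fV), (b \o fE); split; last 2 first.
  - by rewrite -sa sum_imset_iso.
  - by move=> h; apply: nw; apply/winnable_iso.
  exists (K \o fE); split=> [e eC|v vC] /=.
    by rewrite -(iso_len hf); apply: Kb; rewrite (iso_src hf) imset_f.
  by rewrite -(sum_tgt_iso K) Ka// imset_f.
have [g fK gK] := iso_bijV hf.
move=> F F0 Fr; have := hF (F \o g) (fun=> F0 _); rewrite sum_imset_iso /=.
under eq_bigr => v _ do rewrite fK.
move=> /(_ Fr) /winnable_iso; congr (winnable C _ _).
by apply: boolp.funext => v /=; rewrite fK.
Qed.

Lemma adjV_iso x y : adjV (fV x) (fV y) = adjV x y.
Proof.
have [g fK gK] := iso_bijE hf; have fI := bij_inj (iso_bijV hf).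
apply/existsP/existsP => -[e he]; last first.
  by exists (fE e); rewrite (iso_src hf) (iso_tgt hf) !(inj_eq fI).
by exists (g e); rewrite -(gK e) (iso_src hf) (iso_tgt hf) !(inj_eq fI) in he.
Qed.

Lemma connect_iso x y : connect (@adjV R H) (fV x) (fV y) = connect (@adjV R G) x y.
Proof.
have [g fK gK] := iso_bijV hf.
apply/connectP/connectP => -[p hp hl].
  exists (map g p); last by rewrite -[x]fK last_map -hl fK.
  elim: p x hp {hl} => //= z p IH x /andP[xz hp].
  by rewrite -adjV_iso gK xz IH// gK.
exists (map fV p); last by rewrite last_map -hl.
by elim: p x hp {hl} => //= z p IH x /andP[xz hp]; rewrite adjV_iso xz IH.
Qed.

Lemma compo_iso x : compo (fV x) = fV @: compo x.
Proof.
have [g fK gK] := iso_bijV hf.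
apply/setP => y; rewrite -[y]gK (mem_imset _ _ (can_inj fK)) !inE.
exact: connect_iso.
Qed.

Lemma components_iso : components H = [set fV @: (C : {set mV G}) | C in components G].
Proof.
have [g fK gK] := iso_bijV hf.
apply/setP => C; apply/imsetP/imsetP => [[x _ ->]|[_ /imsetP[x _ ->] ->]].
  by exists (compo (g x)); rewrite ?compo_components// -compo_iso gK.
by exists (fV x); rewrite ?compo_iso.
Qed.

Lemma total_rank_iso d p r : total_rank d p r -> total_rank (d \o fV) (p \o fE) r.
Proof.
move=> [rc [hr ->]]; exists (fun C : {set mV G} => rc (fV @: C)); split=> [C CG|].
  by apply/has_rank_iso/hr; rewrite components_iso imset_f.
have inj : {in components G &, injective (fun C : {set mV G} => fV @: C)}.
  by move=> A B _ _; apply/imset_inj/(bij_inj (iso_bijV hf)).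
by rewrite components_iso big_imset// card_in_imset.
Qed.

End Isomorphisms.

(** * Classes of divisors *)

Section WeightedPoints.
Variable R : realType.
Implicit Types S : seq (R * int).

(** Lists of chips or breakpoints may repeat points and contain cancelling entries; only these
    multiplicities are meaningful. *)
Definition mass S (t : R) : int := \sum_(x <- S | x.1 == t) x.2.

Lemma sum_mass (M : zmodType) S (phi : R -> M) (U : seq R) :
  uniq U -> {subset map fst S <= U} ->
  \sum_(x <- S) phi x.1 *~ x.2 = \sum_(t <- U) phi t *~ mass S t.
Proof.
move=> uU; elim: S => [|x S IH] sub.
  by rewrite big_nil big1// => t _; rewrite /mass big_nil mulr0z.
rewrite big_cons IH => [|t tS]; last by apply: sub; rewrite inE tS orbT.
have xU : x.1 \in U by apply: sub; rewrite inE eqxx.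
rewrite !(bigD1_seq x.1 xU uU)/= addrA; congr (_ + _).
  by rewrite /mass big_cons eqxx mulrzDr.
by apply: eq_bigr => t tx; rewrite /mass big_cons eq_sym (negbTE tx).
Qed.

(** The predicate [P] is there because linear equivalence and sections compare multiplicities only
    at interior points of an edge. *)
Lemma eq_mass_sum (M : zmodType) (P : pred R) S S' (phi : R -> M) :
  {in S, forall x, P x.1} -> {in S', forall x, P x.1} ->
  (forall t, P t -> mass S t = mass S' t) ->
  \sum_(x <- S) phi x.1 *~ x.2 = \sum_(x <- S') phi x.1 *~ x.2.
Proof.
move=> PS PS' h; set U := undup (map fst S ++ map fst S').
rewrite !(@sum_mass _ _ _ U) ?undup_uniq//; last 2 first.
- by move=> t tS; rewrite mem_undup mem_cat tS orbT.
- by move=> t tS; rewrite mem_undup mem_cat tS.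
rewrite big_seq [RHS]big_seq; apply: eq_bigr => t; rewrite mem_undup mem_cat => tU.
by rewrite h//; case/orP: tU => /mapP[x xS ->]; [apply: PS | apply: PS'].
Qed.

Lemma sum_mass_ge0 (M : numDomainType) (P : pred R) S (phi : R -> M) :
  {in S, forall x, P x.1} -> (forall t, P t -> 0 <= phi t) -> (forall t, 0 <= mass S t) ->
  0 <= \sum_(x <- S) phi x.1 *~ x.2.
Proof.
move=> PS Pphi h; rewrite (@sum_mass _ _ _ (undup (map fst S))) ?undup_uniq//; last first.
  by move=> t; rewrite mem_undup.
rewrite big_seq; apply: sumr_ge0 => t; rewrite mem_undup => /mapP[x xS ->].
by rewrite mulrz_ge0// Pphi// PS.
Qed.

End WeightedPoints.

Section DivisorClass.
Variables (R : realType) (G : model R).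
Local Notation src := (@msrc R G).
Local Notation tgt := (@mtgt R G).
Local Notation len := (@mlen R G).
Local Notation V := (mV G).
Local Notation E := (mE G).
Implicit Types (C : {set V}) (D : divisor G) (e : E).

Definition edge_chip e (x : point G * int) : option (R * int) :=
  if x.1 is inr y then (if (val y).1 == e then Some ((val y).2, x.2) else None) else None.
Definition edge_chips D e : seq (R * int) := pmap (edge_chip e) D.
Definition edge_deg D e : int := \sum_(x <- edge_chips D e) x.2.
(* The chips inside [e] are moved to its target, at the price of [div_shift]. *)
Definition div_deg D v : int := coefV D v + \sum_(e | tgt e == v) edge_deg D e.
Definition div_shift D e : R := \sum_(x <- edge_chips D e) (x.2)%:~R * (len e - x.1).

Lemma edge_chips_inr y n D e : edge_chips ((inr y, n) :: D) e =
  if (val y).1 == e then ((val y).2, n) :: edge_chips D e else edge_chips D e.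
Proof. by rewrite /edge_chips /= [edge_chip e (_, _)]/edge_chip /=; case: eqP. Qed.

Lemma mass_edge_chips D e t : mass (edge_chips D e) t = coefI D e t.
Proof.
rewrite /mass /coefI; elim: D => [|[[v|[[f s] hs]] n] D IH].
- by rewrite !big_nil.
- by rewrite big_cons /= add0r -IH.
rewrite edge_chips_inr [RHS]big_cons -IH /= xpair_eqE; case: eqP => _ /=; last by rewrite add0r.
by rewrite big_cons /=; case: eqP => _; rewrite ?add0r.
Qed.

Lemma edge_chips_interior D e : {in edge_chips D e, forall x, interior (e, x.1)}.
Proof.
elim: D => [|[[v|[[f s] hs]] n] D IH] // x; rewrite edge_chips_inr /=.
case: eqP => [fe|_] /=; last exact: IH.
by rewrite inE => /orP[/eqP->|]; [rewrite -fe | exact: IH].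
Qed.

Lemma edge_chips_subD D D' e :
  edge_chips (subD D D') e = edge_chips D e ++ [seq (x.1, - x.2) | x <- edge_chips D' e].
Proof.
rewrite {1}/edge_chips /subD pmap_cat; congr (_ ++ _).
elim: D' => [|[[v|y] n] D' IH] //; rewrite edge_chips_inr -[LHS]/(edge_chips ((inr y, - n) :: _) e).
by rewrite edge_chips_inr; case: eqP => _ /=; rewrite -IH.
Qed.

Lemma coefV_subD D D' v : coefV (subD D D') v = coefV D v - coefV D' v.
Proof.
rewrite /coefV /subD big_cat big_map -sumrN; congr (_ + _).
by apply: eq_bigr => -[[w|y] n] _ /=; rewrite ?oppr0//; case: eqP; rewrite ?oppr0.
Qed.

Lemma edge_deg_subD D D' e : edge_deg (subD D D') e = edge_deg D e - edge_deg D' e.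
Proof. by rewrite /edge_deg edge_chips_subD big_cat big_map sumrN. Qed.

Lemma div_deg_subD D D' v : div_deg (subD D D') v = div_deg D v - div_deg D' v.
Proof.
rewrite /div_deg coefV_subD; under eq_bigr => e _ do rewrite edge_deg_subD.
by rewrite sumrB; ring.
Qed.

Lemma div_shift_subD D D' e : div_shift (subD D D') e = div_shift D e - div_shift D' e.
Proof.
rewrite /div_shift edge_chips_subD big_cat big_map -sumrN; congr (_ + _).
by apply: eq_bigr => x _; rewrite mulrNz mulNr.
Qed.

Lemma edge_degE D e : edge_deg D e = \sum_(x <- edge_chips D e) 1 *~ x.2.
Proof. by apply: eq_bigr => x _; rewrite intz. Qed.

Lemma div_shiftE D e : div_shift D e = \sum_(x <- edge_chips D e) (len e - x.1) *~ x.2.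
Proof. by apply: eq_bigr => x _; rewrite mulrzl. Qed.

(** The vertex values and initial slopes of a piecewise linear function are the witnesses of
    [class_eq]. Its breakpoints carry no further choice, being the interior chips of the difference
    of the divisors. *)
Lemma lin_equiv_class D D' : lin_equiv D D' <->
  class_eq (div_deg D) (div_shift D) (div_deg D') (div_shift D').
Proof.
have coefI_sub e t : mass (edge_chips (subD D D') e) t = coefI D e t - coefI D' e t.
  rewrite edge_chips_subD /mass big_cat big_map /= sumrN.
  by rewrite -/(mass _ t) -/(mass _ t) !mass_edge_chips.
split=> [[f [fv [fV fI]]]|[c [s [hd hp]]]].
  have eqm e t : interior (e, t) -> mass (edge_chips (subD D D') e) t = mass (pl_k f e) t.
    by move=> it; rewrite coefI_sub fI.
  have kP e : {in pl_k f e, forall x, interior (e, x.1)} by apply/allP; exact: (fv e).1.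
  exists (pl_c f), (pl_s0 f); split=> [v|e].
    rewrite -div_deg_subD /div_deg coefV_subD fV /divV.
    rewrite [X in _ + X](eq_bigr (fun e => \sum_(x <- pl_k f e) x.2)); last first.
      move=> e _; rewrite edge_degE [RHS](eq_bigr (fun x => 1 *~ x.2)) => [|x _]; last by rewrite intz.
      exact: (eq_mass_sum (fun=> 1) (edge_chips_interior (e := e)) (kP e) (eqm e)).
    by rewrite big_split /=; ring.
  rewrite -div_shift_subD div_shiftE.
  rewrite (eq_mass_sum (fun t => len e - t) (edge_chips_interior (e := e)) (kP e) (eqm e)).
  rewrite (fv e).2; under [X in _ = _ + X - _ - _]eq_bigr => x _ do rewrite mulrzl.
  by ring.
exists (PLFun c s (edge_chips (subD D D'))); split=> [e|]; last split=> [v|e t it] /=.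
- split; first by apply/allP => x /edge_chips_interior.
  by rewrite /= -/(div_shift _ e) div_shift_subD hp; ring.
- by rewrite -coefV_subD /divV /= big_split /= opprD addrA -(hd v) -div_deg_subD addrK.
by rewrite /divI /= -/(mass _ t) coefI_sub.
Qed.

Lemma effective_div_class C D : lengths_pos G -> effective D ->
  effective_class C (div_deg D) (div_shift D).
Proof.
move=> hpos [DV DI]; exists (edge_deg D).
have m0 e t : 0 <= mass (edge_chips D e) t by rewrite mass_edge_chips.
split=> [e _|v _]; last by rewrite /div_deg lerDr.
have pos t : interior (e, t) -> 0 <= t <= len e by case/andP=> /ltW-> /ltW->.
apply/andP; split.
  rewrite div_shiftE.
  apply: (@sum_mass_ge0 R R (fun t => interior (e, t)) _ (fun t => len e - t)) => // [|t].
    exact: edge_chips_interior.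
  by move=> /pos/andP[_]; rewrite subr_ge0.
rewrite -subr_ge0.
have -> : (edge_deg D e)%:~R * len e - div_shift D e = \sum_(x <- edge_chips D e) x.1 *~ x.2.
  rewrite /edge_deg rmorph_sum mulr_suml -sumrB; apply: eq_bigr => x _ /=.
  by rewrite -[RHS]mulrzl; ring.
apply: (@sum_mass_ge0 R R (fun t => interior (e, t)) _ id) => // [|t].
  exact: edge_chips_interior.
by move=> /pos/andP[].
Qed.

Lemma winnable0 C : winnable C (fun=> 0) (fun=> 0 : R).
Proof.
exists (fun=> 0) => v _; rewrite /chips !big1 ?addr0// => e _.
  by rewrite /slope subrr subr0 mul0r oppr0 floor0.
by rewrite /slope subrr subr0 mul0r floor0.
Qed.

Lemma effective_winnable C d p : lengths_pos G -> edge_closed C ->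
  effective_class C d p -> winnable C d p.
Proof.
move=> hpos hC /(winnable_add_effective hpos hC (winnable0 C)).
by apply: winnable_mono => // [v _|e _]; rewrite add0r.
Qed.

Lemma eff_class_winnable C D : lengths_pos G -> edge_closed C ->
  eff_class_on C D -> winnable C (div_deg D) (div_shift D).
Proof.
move=> hpos hC [D' [eD' [_ /lin_equiv_class h]]].
apply: winnable_class_eq (class_eq_sym h) _ => //.
exact/effective_winnable/effective_div_class.
Qed.

Lemma divisor_of_edge_chips (r : E -> seq (R * int)) (s : seq E) : uniq s ->
  (forall e, {in r e, forall x, interior (e, x.1)}) ->
  exists D, (forall v, coefV D v = 0) /\
    forall e, edge_chips D e = if e \in s then r e else [::].
Proof.
move=> us hr; elim: s us => [|f s IH] /=; first by exists [::]; split=> // v; rewrite /coefV big_nil.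
case/andP=> fs /IH[D [D0 DE]].
have [D' [D'0 D'E]] : exists D', (forall v, coefV D' v = 0) /\
    forall e, edge_chips D' e = if e == f then r f else [::].
  have := hr f.
  elim: (r f) => [|x S IHS] hS.
    by exists [::]; split=> [v|e]; [rewrite /coefV big_nil | case: eqP].
  have [|D' [D'0 D'E]] := IHS; first by move=> z zS; apply: hS; rewrite inE zS orbT.
  have xi : interior (f, x.1) by apply: hS; rewrite inE eqxx.
  exists ((inr (exist _ (f, x.1) xi), x.2) :: D'); split=> [v|e].
    by rewrite /coefV big_cons /= add0r; exact: D'0.
  rewrite edge_chips_inr /= D'E eq_sym; case: eqP => //= _.
  by case: (x).
exists (D' ++ D); split=> [v|e].
  by rewrite /coefV big_cat /= -/(coefV _ _) -/(coefV _ _) D0 D'0.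
rewrite /edge_chips pmap_cat -/(edge_chips _ _) -/(edge_chips _ _) D'E DE inE.
by case: eqP => [->|_] //=; rewrite (negbTE fs) cats0.
Qed.

Lemma divisor_of_chips (a : V -> int) (r : E -> seq (R * int)) :
  (forall e, {in r e, forall x, interior (e, x.1)}) ->
  exists D, coefV D =1 a /\ forall e, edge_chips D e = r e.
Proof.
move=> hr; have [D [D0 DE]] := divisor_of_edge_chips (enum_uniq E) hr.
exists ([seq (inl v, a v) | v <- enum V] ++ D); split=> [v|e].
  rewrite /coefV big_cat /= -/(coefV D v) D0 addr0 big_map big_enum /=.
  by rewrite -big_mkcond big_pred1_eq.
rewrite /edge_chips pmap_cat -/(edge_chips D e) DE mem_enum /=.
by elim: (enum V) => //=.
Qed.

Lemma degDE D : degD D = \sum_v coefV D v + \sum_e edge_deg D e.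
Proof.
rewrite /degD /coefV /edge_deg; elim: D => [|[[w|[[f t] hs]] n] D IH].
- by rewrite !big_nil !big1// => i _; rewrite big_nil.
- rewrite big_cons IH addrA /=; congr (_ + _).
  rewrite [RHS](eq_bigr (fun v => (if w == v then n else 0) +
     \sum_(x <- D) match x.1 with inl w => if w == v then x.2 else 0 | inr _ => 0 end)).
    by rewrite big_split/=; congr (_ + _); rewrite -big_mkcond (big_pred1 w)// => v; rewrite eq_sym.
  by move=> v _; rewrite big_cons.
rewrite big_cons IH addrCA; congr (_ + _).
  by apply: eq_bigr => v _; rewrite [RHS]big_cons /= add0r.
rewrite [RHS](eq_bigr (fun e => (if f == e then n else 0) + \sum_(x <- edge_chips D e) x.2)).
  by rewrite big_split/=; congr (_ + _); rewrite -big_mkcond (big_pred1 f)// => v; rewrite eq_sym.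
by move=> e _; rewrite edge_chips_inr /=; case: eqP => _; rewrite ?big_cons ?add0r.
Qed.

Lemma supported_edge_deg C D e : supported_on C D -> src e \notin C ->
  edge_deg D e = 0 /\ div_shift D e = 0.
Proof.
move=> [_ DI] eC; split.
  rewrite edge_degE (eq_mass_sum (S' := [::]) (P := fun t => interior (e, t)) (fun=> 1)) ?big_nil//.
    exact: edge_chips_interior.
  by move=> t _; rewrite mass_edge_chips DI// /mass big_nil.
rewrite div_shiftE (eq_mass_sum (S' := [::]) (P := fun t => interior (e, t)) (fun t => len e - t)) ?big_nil//.
  exact: edge_chips_interior.
by move=> t _; rewrite mass_edge_chips DI// /mass big_nil.
Qed.

Lemma supported_div_deg C D v : edge_closed C -> supported_on C D -> v \notin C ->
  div_deg D v = 0.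
Proof.
move=> hC sD vC; rewrite /div_deg sD.1// big1 ?addr0// => e /eqP ev.
by apply: (supported_edge_deg sD _).1; rewrite hC ev.
Qed.

Lemma degD_supported C D : edge_closed C -> supported_on C D ->
  degD D = \sum_(v in C) div_deg D v.
Proof.
move=> hC sD; rewrite degDE -(sum_fiber tgt predT (edge_deg D)) -big_split/=.
rewrite [RHS]big_mkcond; apply: eq_bigr => v _; case: ifP => // /negbT vC.
by rewrite -/(div_deg D v) (supported_div_deg hC sD).
Qed.

End DivisorClass.

(** * Baker-Norine ranks of divisors as ranks of classes *)

Section RankClass.
Variables (R : realType) (G : model R).
Local Notation src := (@msrc R G).
Local Notation tgt := (@mtgt R G).
Local Notation len := (@mlen R G).
Local Notation V := (mV G).
Local Notation E := (mE G).
Implicit Types (C : {set V}) (D : divisor G) (e : E).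

Hypothesis hpos : lengths_pos G.

(** A winning potential is realised by an actual function with one chip left inside each edge of
    non-integral slope; the vertices keep the nonnegative [chips]. *)
Lemma winnable_eff_class C D : edge_closed C -> supported_on C D ->
  winnable C (div_deg D) (div_shift D) -> eff_class_on C D.
Proof.
move=> hC sD [x hx].
pose y e := slope (div_shift D) x e.
(* The chip must account for the fractional part of the slope: its distance to the target,
   [len e - q e], is that part times [len e]. *)
pose q e := len e * (1 - (y e - (Num.floor (y e))%:~R)).
pose b e := (src e \in C) && (y e \isn't a Num.int).
pose r e : seq (R * int) := if b e then [:: (q e, 1)] else [::].
have [|D' [D'V D'E]] := @divisor_of_chips R G
    (fun v => if v \in C then chips (div_deg D) (div_shift D) x v else 0) r.
  move=> e z; rewrite /r; case: ifP => //; rewrite /b => /andP[_ yn].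
  rewrite inE => /eqP->; rewrite /interior /= /q.
  have := floorD1_gt (y e); rewrite intrD /= => h1.
  have h2 : (Num.floor (y e))%:~R < y e.
    by rewrite lt_neqAle floor_le andbT -intrEfloor.
  apply/andP; split; first by rewrite mulr_gt0//; lra.
  by rewrite gtr_pMr//; lra.
have D'I e t : coefI D' e t = mass (r e) t by rewrite -mass_edge_chips D'E.
have r0 e t : src e \notin C -> mass (r e) t = 0.
  by move=> eC; rewrite /r /b (negbTE eC) /mass big_nil.
exists D'; split; last split.
- split=> [v|e t]; first by rewrite D'V; case: ifP => // /hx.
  by rewrite D'I /mass /r; case: ifP => _; rewrite ?big_nil// big_cons big_nil; case: ifP.
- split=> [v vC|e t eC]; first by rewrite D'V (negbTE vC).
  by rewrite D'I r0.
apply/lin_equiv_class.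
have degD'E e : edge_deg D' e = b2z (b e).
  by rewrite /edge_deg D'E /r; case: (b e); rewrite ?big_nil// big_cons big_nil.
(* Outside [C] both divisors vanish, so the function is taken to be zero there. *)
exists (fun v => if v \in C then x v else 0),
       (fun e => if src e \in C then - Num.floor (y e) else 0); split=> [v|e].
  have [vC|vC] := boolP (v \in C); last first.
    rewrite (supported_div_deg hC sD vC) /div_deg D'V (negbTE vC) !big1 ?subr0//.
    - by move=> e /eqP ev; rewrite hC ev (negbTE vC).
    - by move=> e /eqP ev; rewrite ev (negbTE vC).
    - by move=> e /eqP ev; rewrite degD'E /b hC ev (negbTE vC).
  rewrite {2}/div_deg D'V vC.
  rewrite (eq_bigr (fun e => - Num.floor (y e) - Num.floor (- y e))); last first.
    move=> e /eqP ev; rewrite degD'E /b hC ev vC /= floorN_addr /b2z.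
    by case: (y e \is a Num.int) => /=; ring.
  rewrite [X in _ = X - _](eq_bigr (fun e => - Num.floor (y e))); last first.
    by move=> e /eqP ev; rewrite ev vC.
  rewrite [X in _ = _ - X](eq_bigr (fun e => - Num.floor (y e))); last first.
    by move=> e /eqP ev; rewrite hC ev vC.
  by rewrite /chips -/y !sumrB !sumrN; ring.
have [eC|eC] := boolP (src e \in C); last first.
  rewrite (supported_edge_deg sD eC).2 /div_shift D'E /r /b (negbTE eC) big_nil.
  by rewrite -hC (negbTE eC) !subrr mul0r subrr.
rewrite -hC eC.
have -> : div_shift D' e = (y e - (Num.floor (y e))%:~R) * len e.
  rewrite /div_shift D'E /r /b eC /=; case: (boolP (y e \is a Num.int)) => [|_] /=.
    by rewrite big_nil intrEfloor => /eqP->; rewrite subrr mul0r.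
  by rewrite big_cons big_nil /q /=; ring.
have l0 : len e != 0 by rewrite gt_eqF.
rewrite mulrBl; have -> : y e * len e = div_shift D e - (x (tgt e) - x (src e)).
  by rewrite /y /slope divfK.
by rewrite mulrNz; ring.
Qed.

Lemma edge_chips_restrD C D e :
  edge_chips (restrD C D) e = if src e \in C then edge_chips D e else [::].
Proof.
elim: D => [|[[v|[[f t] hs]] n] D IH]; first by case: ifP.
  rewrite /restrD /=; case: ifP => _; exact: IH.
rewrite edge_chips_inr /restrD /=.
have [fC|fC] := boolP (src f \in C); rewrite ?edge_chips_inr /= -/(restrD C D) IH.
  by have [<-|] := eqVneq f e; rewrite ?fC.
by have [<-|] := eqVneq f e; rewrite ?(negbTE fC).
Qed.

Lemma coefV_restrD C D v : coefV (restrD C D) v = if v \in C then coefV D v else 0.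
Proof.
rewrite /coefV /restrD big_filter big_mkcond /=; case: ifP => vC.
  apply: eq_bigr => -[[w|z] n] _ /=; last by case: ifP.
  by case: ifP => //; case: eqP => // ->; rewrite vC.
rewrite big1// => -[[w|z] n] _ /=; last by case: ifP.
by case: ifP => //; case: eqP => // ->; rewrite vC.
Qed.

Lemma restrD_class C D : edge_closed C ->
  (forall v, v \in C -> div_deg (restrD C D) v = div_deg D v) /\
  (forall e, src e \in C -> div_shift (restrD C D) e = div_shift D e).
Proof.
move=> hC; split=> [v vC|e eC]; last by rewrite /div_shift edge_chips_restrD eC.
rewrite /div_deg coefV_restrD vC; congr (_ + _); apply: eq_bigr => e /eqP ev.
by rewrite /edge_deg edge_chips_restrD hC ev vC.
Qed.

Lemma supported_subD C D D' : supported_on C D -> supported_on C D' ->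
  supported_on C (subD D D').
Proof.
move=> [DV DI] [D'V D'I]; split=> [v vC|e t eC].
  by rewrite coefV_subD DV ?D'V// subr0.
rewrite -mass_edge_chips edge_chips_subD /mass big_cat big_map /= sumrN.
by rewrite -/(mass _ t) -/(mass _ t) !mass_edge_chips DI ?D'I// subr0.
Qed.

Lemma supported_restrD C D : supported_on C (restrD C D).
Proof.
split=> [v vC|e t eC]; first by rewrite coefV_restrD (negbTE vC).
by rewrite -mass_edge_chips edge_chips_restrD (negbTE eC) /mass big_nil.
Qed.

Lemma eff_class_onE C D : edge_closed C -> supported_on C D ->
  eff_class_on C D <-> winnable C (div_deg D) (div_shift D).
Proof. by move=> hC sD; split; [exact: eff_class_winnable | exact: winnable_eff_class]. Qed.

Lemma eff_class_on_subD C D D' : edge_closed C -> supported_on C D' ->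
  eff_class_on C (subD (restrD C D) D') <->
  winnable C (fun v => div_deg D v - div_deg D' v) (fun e => div_shift D e - div_shift D' e).
Proof.
move=> hC sD'; rewrite eff_class_onE//; last exact: supported_subD (supported_restrD C D) sD'.
have [hd hp] := restrD_class D hC.
by split; apply: winnable_mono => // [v vC|e eC]; rewrite ?div_deg_subD ?div_shift_subD ?hd ?hp.
Qed.

(** Failure of [rank_prop] at [r + 1] gives the effective class whose removal is unwinnable;
    [rank_prop] at [r], applied to divisors on vertices, gives the lower bound. *)
Lemma is_rank_conn_has_rank C D r v0 : edge_closed C -> v0 \in C ->
  is_rank_conn C D r -> has_rank C (div_deg D) (div_shift D) r.
Proof.
move=> hC v0C; case=> [[neff ->]|[r0 [hr hmax]]].
  split; last first.
    (* For [r = -1] the lower bound is vacuous: a nonnegative [F] has no negative degree. *)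
    by move=> F F0 /(le_trans _)F1; have := F1 0 (sumr_ge0 _ (fun v _ => F0 v)).
  exists (fun=> 0), (fun=> 0); split; first 1 last.
  - by rewrite big1.
  - move=> hw; apply/neff/eff_class_onE => //; first exact: supported_restrD.
    have [hd hp] := restrD_class D hC.
    by apply: winnable_mono hw => // [v vC|e eC]; rewrite subr0 ?hd ?hp.
  by exists (fun=> 0); split=> [e _|v _]; rewrite ?mul0r ?lexx ?big1.
split.
  have : ~ rank_prop C D (r + 1) by apply: hmax; rewrite ltrDl.
  move=> nr; apply: contrapT => h; apply: nr => E' eE' sE' dE'.
  apply/eff_class_on_subD => //; apply: contrapT => nw; apply: h.
  exists (div_deg E'), (div_shift E'); split=> //; first exact: effective_div_class.
  by rewrite -(degD_supported hC sE').
move=> F F0 Fr.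
(* [rank_prop] tests degree exactly [r], so [F] is topped up at [v0] and cut off outside [C]. *)
pose a v := if v \in C then F v + (if v == v0 then r - \sum_(v in C) F v else 0) else 0.
have [E' [E'V E'E]] := @divisor_of_chips R G a (fun=> [::]) (fun e x (h : x \in [::]) => ltac:(done)).
have Fa v : v \in C -> F v <= a v.
  by rewrite /a => ->; rewrite lerDl; case: ifP => // _; rewrite subr_ge0.
have E'I e t : coefI E' e t = 0 by rewrite -mass_edge_chips E'E /mass big_nil.
have sE' : supported_on C E'.
  by split=> // v vC; rewrite E'V /a (negbTE vC).
have E'd v : div_deg E' v = a v.
  rewrite /div_deg E'V big1 ?addr0// => e _; by rewrite /edge_deg E'E big_nil.
have /eff_class_on_subD : eff_class_on C (subD (restrD C D) E').
  apply: hr => //.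
    split=> [v|e t]; last by rewrite E'I.
    rewrite E'V; have [vC|vC] := boolP (v \in C); last by rewrite /a (negbTE vC).
    exact: le_trans (Fa v vC).
  rewrite (degD_supported hC sE') (eq_bigr _ (fun v _ => E'd v)).
  rewrite (eq_bigr (fun v => F v + (if v == v0 then r - \sum_(v in C) F v else 0))); last first.
    by move=> v vC; rewrite /a vC.
  rewrite big_split /= -big_mkcondr /= [X in _ + X](big_pred1 v0) ?subrKC// => v.
  by apply/andP/eqP => [[_ /eqP]|->] //; rewrite v0C eqxx.
move=> /(_ hC sE'); apply: winnable_mono => // [v vC|e eC].
  by rewrite E'd lerD2l lerN2 Fa.
by rewrite [div_shift E' e]/div_shift E'E big_nil subr0.
Qed.

Lemma is_BN_rank_total_rank D r : is_BN_rank D r -> total_rank (div_deg D) (div_shift D) r.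
Proof.
move=> [rc [hr ->]]; exists rc; split=> // C CG; have [v0 v0C] := component_neq0 CG.
exact: (is_rank_conn_has_rank (component_edge_closed CG) v0C (hr C CG)).
Qed.

End RankClass.

(** * Transition functions *)

Section Transition.
Variables (R : realType) (G : model R).
Local Notation src := (@msrc R G).
Local Notation tgt := (@mtgt R G).
Local Notation len := (@mlen R G).
Local Notation V := (mV G).
Local Notation E := (mE G).

Hypothesis hpos : lengths_pos G.
Hypothesis hloop : forall e, src e != tgt e.

Lemma sum_incident (M : nmodType) (F : E -> M) v :
  \sum_(e | incident e v) F e = \sum_(e | src e == v) F e + \sum_(e | tgt e == v) F e.
Proof.
rewrite (bigID (fun e => src e == v))/=; congr (_ + _); apply: eq_bigl => e.
  by rewrite /incident; case: eqP => //=; rewrite andbF.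
rewrite /incident; case: eqP => [<-|_] /=; last by rewrite andbT.
by rewrite eq_sym (negbTE (hloop e)).
Qed.

Variables (D : divisor G) (s : V -> starsec G).
Hypothesis hs : forall v, is_section D v (s v).

Lemma section_src e : {in ss_k (s (src e)) e, forall x, interior (e, x.1)}.
Proof.
have [_ /(_ e)] := hs (src e); rewrite /incident eqxx => /(_ isT)[/allP h _].
exact: h.
Qed.

Lemma section_tgt e :
  let S := [seq (len e - x.1, x.2) | x <- ss_k (s (tgt e)) e] in
  {in S, forall x, interior (e, x.1)} /\
  forall t, interior (e, t) -> mass S t = coefI D e t.
Proof.
have [_ /(_ e)] := hs (tgt e); rewrite /incident eqxx orbT => /(_ isT)[/allP h1 h2].
split=> [_ /mapP[x /h1 /andP[/= x0 xl] ->]|t it].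
  by rewrite /interior /=; apply/andP; split; lra.
rewrite (h2 t it) /distv (negbTE (hloop e)) /mass big_map; apply: eq_bigl => x /=.
by apply/eqP/eqP => [<-|->]; ring.
Qed.

(** It suffices to look near the source of [e], where no breakpoint of the source section has been
    met and every breakpoint of the target section has been passed. *)
Lemma transition_data e (a : aff R) : lb_transition s e a ->
  a.2 = ss_s0 (s (src e)) e + (ss_s0 (s (tgt e)) e + edge_deg D e) /\
  a.1 = ss_c (s (src e)) - ss_c (s (tgt e))
        - (ss_s0 (s (tgt e)) e + edge_deg D e)%:~R * len e + div_shift D e.
Proof.
move=> ha.
set S := ss_k (s (src e)) e; set S' := [seq (len e - x.1, x.2) | x <- ss_k (s (tgt e)) e].
have [S'i S'm] := section_tgt e; rewrite -/S' in S'i S'm.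
have eqm t : interior (e, t) -> mass S' t = mass (edge_chips D e) t.
  by move=> it; rewrite mass_edge_chips S'm.
have SK : \sum_(x <- S') x.2 = edge_deg D e.
  rewrite edge_degE -(eq_mass_sum (fun=> 1) S'i (edge_chips_interior (e := e)) eqm).
  by apply: eq_bigr => x _; rewrite intz.
have Sp : \sum_(x <- S') (x.2)%:~R * x.1 = (edge_deg D e)%:~R * len e - div_shift D e.
  have -> : \sum_(x <- S') (x.2)%:~R * x.1 = \sum_(x <- S') x.1 *~ x.2.
    by apply: eq_bigr => x _; rewrite mulrzl.
  rewrite (eq_mass_sum id S'i (edge_chips_interior (e := e)) eqm).
  rewrite /edge_deg rmorph_sum mulr_suml -sumrB; apply: eq_bigr => x _ /=.
  by rewrite -[LHS]mulrzl; ring.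
have [|eps e0 he] := @pos_lower_bound R (len e :: map fst S ++ map fst S').
  move=> t; rewrite inE mem_cat => /or3P[/eqP->|/mapP[x /section_src/andP[+ _] ->]|] //.
  by move=> /mapP[x /S'i/andP[+ _] ->].
have lin t : 0 < t -> t < eps -> a.1 + (a.2)%:~R * t =
    ss_c (s (src e)) - ss_c (s (tgt e)) - (ss_s0 (s (tgt e)) e + edge_deg D e)%:~R * len e
    + div_shift D e
    + (ss_s0 (s (src e)) e + (ss_s0 (s (tgt e)) e + edge_deg D e))%:~R * t.
  move=> t0 te; rewrite -ha; last first.
    by rewrite /interior t0 /=; apply: lt_le_trans te _; apply: he; rewrite inE eqxx.
  rewrite /star_val /distv eqxx (negbTE (hloop e)) big_seq big1 => [|x xS]; last first.
    have xe : eps <= x.1 by apply: he; rewrite inE mem_cat map_f ?orbT.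
    by rewrite max_l ?mulr0//; lra.
  have -> : \sum_(x <- ss_k (s (tgt e)) e) (x.2)%:~R * Num.max 0 (len e - t - x.1) =
      \sum_(x <- S') (x.2)%:~R * x.1 - (\sum_(x <- S') x.2)%:~R * t.
    rewrite rmorph_sum mulr_suml -sumrB big_map big_seq [RHS]big_seq.
    apply: eq_bigr => x xS /=.
    have xe : eps <= len e - x.1.
      apply: he; rewrite inE mem_cat; apply/or3P/Or33.
      by apply/mapP; exists (len e - x.1, x.2) => //; apply/mapP; exists x.
    by rewrite max_r; [ring | lra].
  by rewrite SK Sp !intrD; ring.
(* Two points determine the affine function: their difference gives the slope, then one of them the
   constant. *)
have := lin (eps / 2) ltac:(lra) ltac:(lra); have := lin (eps / 4) ltac:(lra) ltac:(lra).
set A := (X in _ = X + _ * _); set B := (ss_s0 _ e + (_ + _)) => h1 h2.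
have : ((a.2)%:~R - B%:~R) * (eps / 4) = 0.
  have -> : ((a.2)%:~R - B%:~R) * (eps / 4) = (a.1 + (a.2)%:~R * (eps / 2))
      - (a.1 + (a.2)%:~R * (eps / 4)) - ((A + B%:~R * (eps / 2)) - (A + B%:~R * (eps / 4))).
    by field.
  by rewrite h1 h2 /A; ring.
move/eqP; rewrite mulf_eq0 -intrB intr_eq0 subr_eq0 (gt_eqF (_ : 0 < eps / 4)) ?orbF; last by lra.
by move=> /eqP aB; split=> //; move: h1; rewrite aB => /addIr.
Qed.

(** Transition functions determine the class of [D]: the slope of [a e] is put at the source of [e]
    and its constant on [e]. The total degree is then the sum of the slopes, as in [bdeg]. *)
Lemma transition_class (a : E -> aff R) : (forall e, lb_transition s e (a e)) ->
  class_eq (div_deg D) (div_shift D) (fun v => \sum_(e | src e == v) (a e).2) (fun e => (a e).1).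
Proof.
move=> ha; exists (fun v => ss_c (s v)), (fun e => - (ss_s0 (s (tgt e)) e + edge_deg D e)).
split=> [v|e]; last by rewrite (transition_data (ha e)).2 mulrNz; ring.
rewrite (eq_bigr (fun e => ss_s0 (s v) e + (ss_s0 (s (tgt e)) e + edge_deg D e))); last first.
  by move=> e /eqP ev; rewrite (transition_data (ha e)).1 ev.
rewrite /div_deg -(hs v).1 sum_incident !sumrN opprK [X in _ = _ + X](eq_bigr
   (fun e => ss_s0 (s v) e + edge_deg D e)) => [|e /eqP<-//].
by rewrite !big_split /=; ring.
Qed.

End Transition.

(** * Covers and vector bundles *)

Section Covers.
Variables (R : realType) (G : model R) (I : finType) (sig : mE G -> {perm I}).
Local Notation GC := (cover_model sig).

Lemma cover_pos : lengths_pos G -> lengths_pos GC.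
Proof. by move=> h x; apply: h. Qed.

Lemma cover_loopless : (forall e : mE G, msrc e != mtgt e) -> forall x : mE GC, msrc x != mtgt x.
Proof. by move=> h [e i] /=; rewrite xpair_eqE negb_and h. Qed.

Lemma sum_cover_src (M : nmodType) (F : mE GC -> M) (v : mV GC) :
  \sum_(x | msrc x == v) F x = \sum_(e | msrc e == v.1) F (e, v.2).
Proof.
case: v => v i /=; rewrite (reindex_onto (fun e => (e, i)) fst) /=.
  by apply: eq_bigl => e; rewrite xpair_eqE !eqxx !andbT.
by move=> [e j] /eqP[_ ->].
Qed.

Lemma sum_cover_tgt (M : nmodType) (F : mE GC -> M) (v : mV GC) :
  \sum_(x | mtgt x == v) F x = \sum_(e | mtgt e == v.1) F (e, (sig e)^-1%g v.2).
Proof.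
case: v => v i /=; rewrite (reindex_onto (fun e => (e, (sig e)^-1%g i)) fst) /=.
  by apply: eq_bigl => e; rewrite xpair_eqE permKV !eqxx !andbT.
by move=> [e j] /eqP[_ <-] /=; rewrite permK.
Qed.

Lemma valz_cover (v : mV GC) : valz v = valz v.1.
Proof. by rewrite !valzE sum_cover_src sum_cover_tgt. Qed.

Lemma class_eq_pullback (d : mV G -> int) (p : mE G -> R) d' p' : class_eq d p d' p' ->
  @class_eq R GC (d \o fst) (p \o fst) (d' \o fst) (p' \o fst).
Proof.
move=> [c [s [hd hp]]]; exists (c \o fst), (s \o fst); split=> [v|e]; last exact: hp.
by rewrite sum_cover_src sum_cover_tgt; apply: hd.
Qed.

End Covers.

Section Bundles.
Variables (R : realType) (G : model R).
Hypothesis hpos : lengths_pos G.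
Hypothesis hloop : forall e : mE G, msrc e != mtgt e.

(** The cover is read off the cocycle itself, with the class of its entries, so that ranks can be
    computed without reference to the presentation chosen in [is_bundle_rank]. *)
Definition bundle_cover (J : finType) (E : cocycle G J) : model R :=
  cover_model (fun e => (E e).1).

Definition bundle_deg (J : finType) (E : cocycle G J) (v : mV (bundle_cover E)) : int :=
  \sum_(x : mE (bundle_cover E) | msrc x == v) ((E x.1).2 x.2).2.

Definition bundle_shift (J : finType) (E : cocycle G J) (x : mE (bundle_cover E)) : R :=
  ((E x.1).2 x.2).1.

Lemma sum_bundle_deg (J : finType) (E : cocycle G J) : \sum_v bundle_deg (E := E) v = bdeg E.
Proof. by rewrite (sum_fiber _ predT) /= /bdeg pair_bigA. Qed.

Section Isomorphic.
Variables (J : finType) (E P : cocycle G J) (sig : mE G -> {perm J}).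
Variable h : mV G -> {perm J} * (J -> harm G).
Hypothesis sigP : forall e, (P e).1 = sig e.
Hypothesis hok : forall v i, harm_ok v ((h v).2 i).
Hypothesis hE : forall e, E e = gmul (gmul (restrG (msrc e) (h (msrc e)) e) (P e))
                                (ginv (restrG (mtgt e) (h (mtgt e)) e)).

Definition bundle_isoV (v : mV (bundle_cover E)) : mV (cover_model sig) := (v.1, (h v.1).1 v.2).
(** The sheets over an edge are labelled by the lifts of its source, so the permutation at the
    source relabels them. *)
Definition bundle_isoE (x : mE (bundle_cover E)) : mE (cover_model sig) :=
  (x.1, (h (msrc x.1)).1 x.2).

Lemma bundle_iso_model_iso : model_iso bundle_isoV bundle_isoE.
Proof.
split=> //.
- exists (fun v => (v.1, ((h v.1).1)^-1%g v.2)) => -[v i]; rewrite /bundle_isoV /=.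
    by rewrite permK.
  by rewrite permKV.
- exists (fun x => (x.1, ((h (msrc x.1)).1)^-1%g x.2)) => -[v i]; rewrite /bundle_isoE /=.
    by rewrite permK.
  by rewrite permKV.
- by move=> [e i]; rewrite /bundle_isoV /bundle_isoE /= hE /= !permM permKV sigP.
Qed.

Lemma bundle_iso_class_eq :
  @class_eq R (bundle_cover E)
    ((fun v => \sum_(x : mE (cover_model sig) | msrc x == v) ((P x.1).2 x.2).2) \o bundle_isoV)
    ((fun x => ((P x.1).2 x.2).1) \o bundle_isoE)
    (bundle_deg (E := E)) (bundle_shift (E := E)).
Proof.
apply: class_eq_sym.
(* The values of the harmonic functions [h] give the potential, and their slopes out of the target
   end give [s]; harmonicity converts the slopes at the source ends into the sum over incoming
   edges. *)
exists (fun v => - ((h v.1).2 v.2).1), (fun x => ((h (mtgt x.1)).2 ((E x.1).1 x.2)).2 x.1).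
have EE e i : (E e).2 i =
    Defs.addA (Defs.addA (((h (msrc e)).2 i).1, ((h (msrc e)).2 i).2 e) ((P e).2 ((h (msrc e)).1 i)))
      (Defs.negA (((h (mtgt e)).2 ((E e).1 i)).1 + (((h (mtgt e)).2 ((E e).1 i)).2 e)%:~R * mlen e,
             - ((h (mtgt e)).2 ((E e).1 i)).2 e)).
  rewrite hE /= /restrH eqxx (negbTE (hloop e)).
  by rewrite !permM sigP.
split=> [v|[e i]]; last first.
  by rewrite /bundle_shift /= EE /=; ring.
rewrite /comp (sum_src_iso bundle_iso_model_iso) /bundle_deg -sumrB.
rewrite (eq_bigr (fun x : mE (bundle_cover E) => ((h v.1).2 v.2).2 x.1
    + ((h (mtgt x.1)).2 ((E x.1).1 x.2)).2 x.1)); last first.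
  by move=> [e i] /eqP <- /=; rewrite EE /=; ring.
rewrite big_split /= addrC; congr (_ + _).
rewrite [X in _ = - X](eq_bigr (fun x : mE (bundle_cover E) => ((h v.1).2 v.2).2 x.1)); last first.
  by move=> [e i] /eqP <-.
rewrite sum_cover_src sum_cover_tgt /=; apply/eqP; rewrite -addr_eq0.
by rewrite -(sum_incident hloop); apply/eqP/hok.
Qed.

End Isomorphic.

(** The rank is carried from the divisor to the transition functions of its pushforward, then along
    the isomorphism of covers, then to the entries of [E]. *)
Lemma bundle_rank_class (J : finType) (E : cocycle G J) r : is_bundle_rank E r ->
  total_rank (bundle_deg (E := E)) (bundle_shift (E := E)) r.
Proof.
move=> [sig [D [s [hsec [[P [hP [h [hok hE]]]] hr]]]]].
have sigP e := (hP e).1.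
have h0 := is_BN_rank_total_rank (cover_pos hpos) hr.
have ha x : lb_transition s x ((P x.1).2 x.2) by case: x => e i; exact: (hP e).2.
have h1 := total_rank_class_eq (cover_pos hpos)
  (transition_class (cover_pos hpos) (cover_loopless hloop) hsec ha) h0.
have h2 := total_rank_iso (bundle_iso_model_iso sigP hE) h1.
exact: (total_rank_class_eq (cover_pos hpos) (bundle_iso_class_eq sigP hok hE) h2).
Qed.

End Bundles.

Theorem theorem4p3 (R : realType) (G : model R)
  (hpos : lengths_pos G) (hsimple : simple_model G)
  (I : finType) (E : cocycle G I)
  (sK : mV G -> starsec G) (hsK : forall v, is_section (canonical_div G) v (sK v))
  (L : cocycle G 'I_1) (hL : is_lb_cocycle sK L)
  (r1 r2 : int) :
  is_bundle_rank E r1 ->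
  is_bundle_rank (tensor L (dual E)) r2 ->
  r1 - r2 = bdeg E + (#|I|)%:Z * euler_char G.
Proof.
have hloop := hsimple.1.
move=> /(bundle_rank_class hpos hloop) h1 /(bundle_rank_class hpos hloop) h2.
set T := tensor L (dual E) in h2.
(* Dualising keeps the permutations and tensoring with a rank one bundle adds only the index [ord0],
   so both bundles live on the same cover. *)
pose fV (v : mV (bundle_cover E)) : mV (bundle_cover T) := (v.1, (ord0, v.2)).
pose fE (x : mE (bundle_cover E)) : mE (bundle_cover T) := (x.1, (ord0, x.2)).
have iso : model_iso fV fE.
  split=> //.
  - by exists (fun v => (v.1, v.2.2)) => -[v] // [o i]; rewrite /fV /= (ord1 o).
  - by exists (fun v => (v.1, v.2.2)) => -[v] // [o i]; rewrite /fE /= (ord1 o).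
  - by move=> [e i]; rewrite /fV /= /T /tensor /= permE /pprod_fun /= ord1.
have {}h2 := total_rank_iso iso h2.
have K0 e : edge_chips (canonical_div G) e = [::].
  by rewrite /edge_chips /canonical_div; elim: (enum _) => //=.
have KV v : div_deg (canonical_div G) v = valz v - 2.
  rewrite /div_deg big1 => [|e _]; last by rewrite /edge_deg K0 big_nil.
  rewrite addr0 /coefV /canonical_div big_map big_enum /=.
  by rewrite -big_mkcond big_pred1_eq.
have hK := transition_class hpos hloop hsK (a := fun e => (L e).2 ord0) (fun e => (hL e).2).
have := class_riemann_roch (cover_pos hpos) (cover_loopless hloop) h1 h2.
rewrite sum_bundle_deg => ->.
  by rewrite /euler_char !card_prod !PoszM; ring.
(* In the sum of the two classes the entries of [E] cancel, leaving the pullback of [L]; it is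
   canonical on the cover because covers preserve valences. *)
have /class_eq_sym := @class_eq_pullback _ _ _ (fun e => (E e).1) _ _ _ _ hK.
move=> [c [s [hd hp]]]; exists c, s; split=> [v|x].
  rewrite -hd /= KV valz_cover; congr (_ - _).
  rewrite /bundle_deg (sum_src_iso iso) -big_split sum_cover_src /=.
  by apply: eq_bigr => e _; ring.
rewrite -hp /= /div_shift K0 big_nil /bundle_shift /=.
by congr (_ - _); rewrite addrC subrK.
Qed.
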